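(* Let $Z=(Z^1,Z^2)$ be a Lévy process with values in $\mathbb{R}^2$, centered and without Gaussian part, whose Lévy measure is given in polar coordinates by $\sigma(dx,dy)=\nu(dr)\,\tau(d\theta)$, where $\tau$ is the uniform probability measure on the circle and $\nu$ is a measure on $\mathbb{R}_+^\ast=(0,\infty)$, and suppose that $\sigma$ integrates $r^2=x^2+y^2$. If $\nu(\mathbb{R}_+^\ast)=+\infty$, then for every $t>0$ the random variable $Z_t$ possesses a density with respect to Lebesgue measure on $\mathbb{R}^2$.
   Context: ''Polar coordinates'' means that $\sigma$ is the image of $\nu\otimes\tau$ under $(r,\theta)\mapsto(r\cos\theta,r\sin\theta)$. ''Centered without Gaussian part'' means that $Z_t=\int_{[0,t]\times\mathbb{R}^2}(x,y)\,\tilde N(ds\,dx\,dy)$, where $N$ is the Poisson random measure of jumps of $Z$ on $\mathbb{R}_+\times\mathbb{R}^2$ with intensity $ds\times\sigma$ and $\tilde N=N-ds\times\sigma$ is the compensated measure. *)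

(* Defs.v *)
From HB Require Import structures.
From mathcomp Require Export all_boot all_order all_algebra.
From mathcomp Require Export all_classical all_reals all_analysis measurable_realfun.

Set Implicit Arguments.
Unset Strict Implicit.
Unset Printing Implicit Defensive.

Import Order.TTheory GRing.Theory Num.Theory.
Import numFieldNormedType.Exports.

Local Open Scope classical_set_scope.
Local Open Scope ring_scope.

Section independence.
Context d (T : measurableType d) (R : realType) (P : probability T R).

(* Taking B i = setT for some indices gives the product rule for every
   subfamily. *)
Definition mutually_independent (I : finType) d' (E : measurableType d')
    (X : I -> T -> E) : Prop :=
  forall B : I -> set E, (forall i, measurable (B i)) ->
    P (\bigcap_i (X i @^-1` B i)) = (\prod_i P (X i @^-1` B i))%E.

End independence.

Section paths.
Context (R : realType).
Implicit Types z : R -> R * R.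

Definition cadlag z : Prop :=
  (forall s, 0 <= s -> z u @[u --> s^'+] --> z s) /\
  (forall s, 0 < s -> exists l : R * R, z u @[u --> s^'-] --> l).

(* Coordinatewise because R * R has no canonical pointed topological structure,
   which lim requires. *)
Definition left_limit z (s : R) : R * R :=
  (lim ((z u).1 @[u --> s^'-]), lim ((z u).2 @[u --> s^'-])).

Definition jump z (s : R) : R * R := z s - left_limit z s.

Definition jump_count z (B : set (R * (R * R))) : \bar R :=
  counting [set s | [/\ 0 < s, jump z s <> 0 & B (s, jump z s)]].

End paths.

Section processes.
Context d (T : measurableType d) (R : realType) (P : probability T R).

(* Processes are indexed by R; only their values at times t >= 0 matter. *)
Record levy_process (Z : R -> T -> R * R) : Prop := {
  levy_measurable : forall t, 0 <= t -> measurable_fun setT (Z t) ;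
  levy_start : {ae P, forall w, Z 0 w = 0} ;
  levy_independent_increments : forall (n : nat) (t : nat -> R),
    0 <= t 0 -> {homo t : i j / (i <= j)%N >-> i <= j} ->
    mutually_independent P
      (fun (i : 'I_n) (w : T) => Z (t i.+1) w - Z (t i) w) ;
  levy_stationary_increments : forall s t, 0 <= s -> 0 <= t ->
    forall A : set (R * R), measurable A ->
      P ((fun w => Z (s + t) w - Z s w) @^-1` A) = P (Z t @^-1` A) ;
  levy_cadlag : {ae P, forall w, cadlag (Z ^~ w)} }.

Definition jump_measure_of (Z : R -> T -> R * R)
    (N : T -> {measure set (R * (R * R)) -> \bar R}) : Prop :=
  {ae P, forall w, forall B : set (R * (R * R)), measurable B ->
     N w B = jump_count (Z ^~ w) B}.

(* The second argument of poisson_prob is a dummy. The library's poisson_prob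
   is the Dirac mass at 0 when the rate is 0 (whereas poisson_pmf 0 is not a
   probability mass function). An infinite mean means infinite almost surely. *)
Definition poisson_distributed (X : T -> \bar R) (m : \bar R) : Prop :=
  if m is r%:E then
    forall k : nat, P (X @^-1` [set k%:R%:E]) = poisson_prob r 0 [set k]
  else P (X @^-1` [set +oo%E]) = 1%E.

Record poisson_random_measure d' (E : measurableType d')
    (N : T -> {measure set E -> \bar R}) (mu : {measure set E -> \bar R})
    : Prop := {
  prm_measurable : forall B, measurable B ->
    measurable_fun setT (fun w => N w B) ;
  prm_poisson : forall B, measurable B ->
    poisson_distributed (fun w => N w B) (mu B) ;
  prm_independent : forall (n : nat) (B : 'I_n -> set E),
    (forall i, measurable (B i)) -> trivIset setT B ->
    mutually_independent P (fun (i : 'I_n) (w : T) => N w (B i)) }.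

(* I is (a version of) the integral of f against N - mu. On integrable, square
   integrable functions g this is the difference of the two Lebesgue
   integrals; it extends to all of L^2(mu) by continuity, since
   g |-> int g dN - int g dmu is an isometry from L^2(mu) to L^2(P). *)
Definition compensated_integral d' (E : measurableType d')
    (N : T -> {measure set E -> \bar R}) (mu : {measure set E -> \bar R})
    (f : E -> R) (I : T -> R) : Prop :=
  [/\ measurable_fun setT I,
      f \in Lfun mu 2%:E &
      forall g : nat -> E -> R,
        (forall n, g n \in Lfun mu 1 /\ g n \in Lfun mu 2%:E) ->
        Lnorm mu 2%:E (EFin \o (g n \- f)) @[n --> \oo] --> 0%E ->
        Lnorm P 2%:E (EFin \o (fun w =>
           \int[N w]_x g n x - \int[mu]_x g n x - I w)) @[n --> \oo] --> 0%E].

Definition centered_without_gaussian_part (Z : R -> T -> R * R)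
    (N : T -> {measure set (R * (R * R)) -> \bar R})
    (mu : {measure set (R * (R * R)) -> \bar R}) : Prop :=
  forall t, 0 <= t ->
    compensated_integral N mu (fun p => \1_`[0, t] p.1 * p.2.1)
      (fun w => (Z t w).1) /\
    compensated_integral N mu (fun p => \1_`[0, t] p.1 * p.2.2)
      (fun w => (Z t w).2).

Definition has_density (X : T -> R * R) : Prop :=
  exists f : R * R -> R,
    [/\ measurable_fun setT f, forall z, 0 <= f z &
        forall A : set (R * R), measurable A ->
          P (X @^-1` A) =
          (\int[lebesgue_measure \x lebesgue_measure]_(z in A) (f z)%:E)%E].

End processes.

Section measures.
Context (R : realType).

Definition polar (p : R * R) : R * R := (p.1 * cos p.2, p.1 * sin p.2).

Lemma measurable_polar : measurable_fun setT polar.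
Proof.
apply: measurable_fun_pair; apply: measurable_funM => //;
  apply: measurableT_comp => //; apply: continuous_measurable_fun.
- exact: continuous_cos.
- exact: continuous_sin.
Qed.

Lemma zero_lt_2pi : 0 < 2 * pi :> R.
Proof. by rewrite mulr_gt0// pi_gt0. Qed.

(* The uniform probability on the circle, in terms of the angle. *)
Definition uniform_angle := uniform_prob zero_lt_2pi.

(* The image of nu(dr) tau(dtheta). A measure on (0, oo) is represented by a
   measure nu on R such that nu ]-oo, 0] = 0. *)
Definition polar_measure (nu : {measure set R -> \bar R})
    : set (R * R) -> \bar R :=
  pushforward (nu \x uniform_angle)%E polar.

Section polar_measure_instance.
Variable nu : {measure set R -> \bar R}.

Let polar_measure0 : polar_measure nu set0 = 0%E.
Proof. by rewrite /polar_measure /pushforward preimage_set0 measure0. Qed.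

Let polar_measure_ge0 A : (0 <= polar_measure nu A)%E.
Proof. by rewrite /polar_measure /pushforward measure_ge0. Qed.

Let polar_measure_sigma_additive : semi_sigma_additive (polar_measure nu).
Proof.
by apply: measure_semi_sigma_additive; exact: measurable_polar.
Qed.

HB.instance Definition _ := isMeasure.Build _ _ _ (polar_measure nu)
  polar_measure0 polar_measure_ge0 polar_measure_sigma_additive.

End polar_measure_instance.

Lemma measurable_nonneg_times :
  measurable (`[0, +oo[%classic `*` setT : set (R * (R * R))).
Proof. exact: measurableX. Qed.

(* ds sigma(dz) on [0, oo) * R^2, as a measure on R * R^2. The variant \x^ of
   the product only needs Lebesgue measure, not sigma, to be sigma-finite by
   type. *)
Definition time_intensity (sigma : {measure set (R * R) -> \bar R})
    : set (R * (R * R)) -> \bar R :=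
  mrestr (lebesgue_measure \x^ sigma)%E measurable_nonneg_times.

Section time_intensity_instance.
Variable sigma : {measure set (R * R) -> \bar R}.

Let time_intensity0 : time_intensity sigma set0 = 0%E.
Proof. by rewrite /time_intensity measure0. Qed.

Let time_intensity_ge0 A : (0 <= time_intensity sigma A)%E.
Proof. by rewrite /time_intensity measure_ge0. Qed.

Let time_intensity_sigma_additive : semi_sigma_additive (time_intensity sigma).
Proof.
move=> F mF tF mUF.
exact: (@measure_semi_sigma_additive _ _ _
  (mrestr (lebesgue_measure \x^ sigma)%E measurable_nonneg_times) F mF tF mUF).
Qed.

HB.instance Definition _ := isMeasure.Build _ _ _ (time_intensity sigma)
  time_intensity0 time_intensity_ge0 time_intensity_sigma_additive.

End time_intensity_instance.

End measures.

(* Main.v *)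
Require Import Defs.
From HB Require Import structures.
From mathcomp Require Import ring lra.
Import Order.TTheory GRing.Theory Num.Theory.
Import numFieldNormedType.Exports.

(** The Levy measure is rotation-invariant and Z_s is a limit of functions of
    finitely many Poisson counts, whose joint law depends only on their
    intensities. So the law of Z_s is rotation-invariant for every s
    (compensated_pair_rotation, levy_law_rotation_invariant): it is a mixture of
    uniform laws on circles centred at 0, and its only possible atom is 0.

    For s > 0, the point 0 is not an atom either (levy_no_atom). Let u < s. As
    Z_u and Z_s - Z_u are independent and have no atom outside 0, they are almost
    surely never nonzero and opposite; so Z_s = 0 forces Z_u = 0 for all rational
    u < s. Since the paths are right continuous, Z then vanishes on ]0, s[ and
    does not jump there, whereas the infinite mass of nu makes the number of jumps
    before s almost surely infinite.

    Hence Z_t is the sum of Z_(t/2) and of an independent vector with the same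
    law, both isotropic and almost surely nonzero. Given their lengths r and r',
    the square of the length of the sum is r^2 + r'^2 + 2 r r' cos b with b
    uniform, so that |Z_t| avoids every given null set (modulus_sum_null).
    Together with the isotropy of Z_t, and since a null set of the plane meets
    almost every circle centred at 0 in a null set of angles
    (polar_null_sections), this shows that Z_t avoids every null set of the plane
    (sum_dominated). The density is then given by the Radon-Nikodym theorem. *)

Set Implicit Arguments.
Unset Strict Implicit.
Unset Printing Implicit Defensive.
Local Open Scope classical_set_scope.
Local Open Scope ring_scope.

(** * Null sets under maps of the line *)

Section null_preimages.
Context {R : realType}.
Let mu := @lebesgue_measure R.
Let l := @wlength R idfun.

Definition expanding_on (f : R -> R) (J : set R) :=
  exists2 c : R, 0 < c & forall x y, J x -> J y -> c * `|x - y| <= `|f x - f y|.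

(** An interval of length l pulls back to a set of diameter at most l / c, so a
    cover of B by intervals of small total length gives one of the preimage. *)
Lemma negligible_preimage_expanding (f : R -> R) (J B : set R) :
  expanding_on f J -> mu.-negligible B -> mu.-negligible (J `&` f @^-1` B).
Proof.
move=> [c c0 fJ] /negligible_outer_measure B0; apply/negligible_outer_measure.
apply/eqP; rewrite eq_le outer_measure_ge0 andbT; apply/lee_addgt0Pr => e e0.
rewrite add0e.
have ce0 : 0 < c / 2 * e by rewrite !mulr_gt0.
have [F [Fitv BF] Fe] : exists2 I_, open_itv_cover B I_ &
    (\sum_(0 <= k <oo) l (I_ k) <= (c / 2 * e)%:E)%E.
  move: B0; rewrite outer_measure_open_itv_cover => B0.
  have : ereal_inf [set (\sum_(k <oo) l (F k))%E
    | F in open_itv_cover B] \is a fin_num by rewrite B0.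
  move=> /lb_ereal_inf_adherent-/(_ _ ce0)[_/= [F]] AF <- Fe.
  by exists F => //; apply/ltW; rewrite B0 add0e in Fe.
(* The preimage of an interval of length b - a lies in a closed ball of radius
   (b - a) / c around any of its points; whence the factor 2 / c. *)
have wle k : ((l^* (J `&` f @^-1` F k))%mu <= (2 / c)%:E * l (F k))%E.
  have [[a b] /= ->] := Fitv k.
  have [->|/set0P[x [Jx]]] := eqVneq (J `&` f @^-1` `]a, b[) set0.
    by rewrite outer_measure0 mule_ge0// ?lee_fin ?divr_ge0// 1?ltW// wlength_ge0.
  rewrite /= in_itv/= => /andP[afx fxb].
  have ab : a < b by apply: lt_trans fxb.
  apply: (@le_trans _ _ (mu (closed_ball x ((b - a) / c)))).
    rewrite /mu; apply: le_outer_measure => y [Jy] /=.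
    rewrite in_itv/= => /andP[afy fyb].
    rewrite closed_ballE /closed_ball_/= ?divr_gt0 ?subr_gt0//.
    rewrite ler_pdivlMr// mulrC (le_trans (fJ _ _ Jx Jy))//.
    by rewrite ler_norml; lra.
  rewrite /mu lebesgue_measure_closed_ball; last first.
    by apply: divr_ge0; [rewrite subr_ge0|]; exact: ltW.
  rewrite /l wlength_itv/= lte_fin ab -EFinB -EFinM lee_fin.
  rewrite le_eqVlt; apply/orP; left; apply/eqP.
  by rewrite -mulr_natl; field; rewrite gt_eqF.
apply: (@le_trans _ _ (\sum_(k <oo) (2 / c)%:E * l (F k))%E).
  apply: (@le_trans _ _ (l^* (\bigcup_k (J `&` f @^-1` F k)))%mu).
    apply: le_outer_measure => x [Jx /BF[k _ Fk]]; exists k => //.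
  apply: (le_trans (outer_measure_sigma_subadditive _ _)).
  by apply: lee_nneseries => [k _ _|k _]; [exact: outer_measure_ge0|exact: wle].
rewrite nneseriesZl; first last.
- by move=> k _; exact: wlength_ge0.
have cc0 : (0 <= (2 / c)%:E)%E by rewrite lee_fin divr_ge0 ?ltW.
apply: (@le_trans _ _ ((2 / c)%:E * (c / 2 * e)%:E)%E).
  exact: lee_wpmul2l.
rewrite -EFinM lee_fin le_eqVlt; apply/orP; left; apply/eqP.
by field; rewrite gt_eqF.
Qed.

(** Intervals with rational endpoints cut D into countably many pieces. *)
Lemma negligible_preimage_locally_expanding (f : R -> R) (D B : set R) :
  (forall x, D x -> exists2 e : R, 0 < e & expanding_on f `]x - e, x + e[%classic) ->
  mu.-negligible B -> mu.-negligible (D `&` f @^-1` B).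
Proof.
move=> fD B0.
pose J (q : rat * rat) : set R :=
  [set x | expanding_on f `]ratr q.1, ratr q.2[%classic /\
           `]ratr q.1, ratr q.2[%classic x].
pose G n := if unpickle n is Some q then J q `&` f @^-1` B else set0.
apply: (@negligibleS _ _ _ mu (\bigcup_n G n)).
  move=> x [Dx Bfx]; have [e e0 fe] := fD x Dx.
  have /rat_in_itvoo[p pP] : x - e < x by lra.
  have /rat_in_itvoo[q qP] : x < x + e by lra.
  move: pP qP; rewrite !in_itv/= => /andP[p1 p2] /andP[q1 q2].
  exists (pickle (p, q)); first exact: I.
  rewrite /G pickleK; split; last exact: Bfx.
  split => /=.
    case: fe => c c0 fe; exists c => // y z /=; rewrite !in_itv/= => yP zP.
    by apply: fe => /=; rewrite in_itv/=; lra.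
  by rewrite in_itv/= p2 q1.
apply: negligible_bigcup => n; rewrite /G.
case: (unpickle n) => [q|]; last exact: negligible_set0.
have [fe|fe] := pselect (expanding_on f `]ratr q.1, ratr q.2[%classic).
  apply: (negligibleS _ (negligible_preimage_expanding fe B0)).
  by move=> x [[]].
by apply: (negligibleS _ (negligible_set0 _)) => x [[]].
Qed.

(** By the mean value theorem, a C1 map is expanding near every point where its
    derivative does not vanish. *)
Lemma negligible_preimage_C1 (f df : R -> R) (D B : set R) :
  (forall x, D x -> [/\ df x != 0, {for x, continuous df} &
     \forall y \near x, is_derive (y : R) 1 f (df y)]) ->
  mu.-negligible B -> mu.-negligible (D `&` f @^-1` B).
Proof.
move=> fD; apply: negligible_preimage_locally_expanding => x /fD[dfx cdf fdf].
have c0 : 0 < `|df x| / 2 by rewrite divr_gt0// normr_gt0.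
have /= : \forall y \near x, is_derive (y : R) 1 f (df y) /\ `|df x| / 2 <= `|df y|.
  near=> y; split; first by near: y.
  have : `|df x - df y| < `|df x| / 2.
    by near: y; move/cvgrPdist_lt : cdf; apply.
  move=> h; have := ler_distD (df y) (df x) 0; rewrite !subr0; lra.
move=> /nbhs_ballP[e /= e0 H]; exists e => //.
have {}H y : `]x - e, x + e[%classic y ->
    is_derive y 1 f (df y) /\ `|df x| / 2 <= `|df y|.
  by move=> xy; apply: H; rewrite ball_itv.
exists (`|df x| / 2) => //.
suff K y z : `]x - e, x + e[%classic y -> `]x - e, x + e[%classic z -> y < z ->
    `|df x| / 2 * `|y - z| <= `|f y - f z|.
  move=> y z Jy Jz; have [yz|zy|->] := ltgtP y z; first exact: K.
    by rewrite distrC (distrC (f y)); exact: K.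
  by rewrite !subrr normr0 mulr0.
move=> /=; rewrite !in_itv/= => Jy Jz yz.
have sub w : w \in `[y, z] -> `]x - e, x + e[%classic w.
  rewrite /= !in_itv/= => wyz; lra.
have [w wyz E] := MVT yz (fun w wyz => (H w (sub w (subset_itv_oo_cc wyz))).1)
  (derivable_within_continuous (fun w wyz =>
     @ex_derive _ _ _ _ _ _ _ (H w (sub w wyz)).1)).
rewrite distrC (distrC (f y)) E normrM ler_wpM2r//.
exact: (H w (sub w (subset_itv_oo_cc wyz))).2.
Unshelve. all: by end_near. Qed.

End null_preimages.

Section trigonometric_preimages.
Context {R : realType}.
Let mu := @lebesgue_measure R.

Lemma continuous_cosB (p : R) : continuous (fun b => cos (b - p)).
Proof.
move=> x; apply: (@continuous_comp _ _ _ (fun b => b - p) cos);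
  last exact: continuous_cos.
by apply: cvgB => //; exact: cvg_cst.
Qed.

Lemma continuous_sinB (p : R) : continuous (fun b => sin (b - p)).
Proof.
move=> x; apply: (@continuous_comp _ _ _ (fun b => b - p) sin);
  last exact: continuous_sin.
by apply: cvgB => //; exact: cvg_cst.
Qed.

Lemma is_derive_cosB (p x : R) : is_derive x 1 (fun b => cos (b - p)) (- sin (x - p)).
Proof.
rewrite -[X in is_derive _ _ _ X]mulr1.
apply: (@is_derive1_comp _ cos (fun b => b - p)).
by apply: is_derive_eq; rewrite subr0.
Qed.

Lemma is_derive_sinB (p x : R) : is_derive x 1 (fun b => sin (b - p)) (cos (x - p)).
Proof.
rewrite -[X in is_derive _ _ _ X]mulr1.
apply: (@is_derive1_comp _ sin (fun b => b - p)).
by apply: is_derive_eq; rewrite subr0.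
Qed.

(** Where the sine vanishes the cosine does not: the zeros lie in the preimage
    of the null set {0} under a map with nonzero derivative. *)
Lemma negligible_sin0 (p : R) : mu.-negligible [set b | sin (b - p) = 0].
Proof.
have n0 : mu.-negligible [set 0 : R].
  by apply/negligibleP => //; exact: lebesgue_measure_set1.
apply: (negligibleS _ (@negligible_preimage_C1 _ (fun b => sin (b - p))
  (fun b => cos (b - p)) [set b | cos (b - p) != 0] _ _ n0)).
- move=> b /= sb; split => //; apply: contra_eqN sb => /eqP cb.
  have := cos2Dsin2 (b - p); rewrite cb expr0n/= add0r => /eqP.
  by rewrite sqrf_eq1 => /orP[]/eqP->;
    rewrite ?oppr_eq0 oner_eq0.
- move=> b /= cb; split => //; first exact: continuous_cosB.
  by near=> y; exact: is_derive_sinB.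
Unshelve. all: by end_near. Qed.

Lemma negligible_cos0 : mu.-negligible [set b : R | cos b = 0].
Proof.
apply: (negligibleS _ (negligible_sin0 (- (pi / 2)))) => b /=.
by rewrite opprK sinDpihalf.
Qed.

Lemma negligible_preimage_tan (B : set R) : mu.-negligible B ->
  mu.-negligible [set a | cos a != 0 /\ B (tan a)].
Proof.
apply: (@negligible_preimage_C1 _ tan (fun a => (cos a)^-2)
  [set a | cos a != 0]) => a /= ca; split.
- by rewrite invr_neq0// expf_neq0.
- apply: cvgV; first by rewrite expf_neq0.
  by apply: cvgM; exact: continuous_cos.
- have /= := cvgr_neq0 (cos a) (@continuous_cos R a) ca.
  move=> /(_ (nbhs_filter _)) H; near=> y.
  by apply: is_derive_tan; near: y; exact: H.
Unshelve. all: by end_near. Qed.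

Lemma negligible_preimage_mulr (k : R) (B : set R) : k != 0 -> mu.-negligible B ->
  mu.-negligible [set a | B (a * k)].
Proof.
move=> k0 B0; rewrite (_ : [set a | _] = setT `&` (fun a => a * k) @^-1` B); last first.
  by rewrite setTI.
apply: (@negligible_preimage_C1 _ (fun a => a * k) (cst k)) => // a _ /=.
split => //; first exact: cvg_cst.
near=> y; apply: is_derive_eq.
by rewrite /GRing.scale/= ?mulr0 ?add0r ?mulr1.
Unshelve. all: by end_near. Qed.

(** The square root is the length of the sum of a vector of length r and angle p
    and a vector of length s and angle b. As a function of b it is C1, with
    nonzero derivative, wherever sin (b - p) does not vanish. *)
Lemma negligible_preimage_law_of_cosines (r s p : R) (B : set R) :
  0 < r -> 0 < s -> mu.-negligible B ->
  mu.-negligible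
    [set b | B (Num.sqrt (r ^+ 2 + s ^+ 2 + 2 * r * s * cos (b - p)))].
Proof.
move=> r0 s0 B0.
pose G b : R := r ^+ 2 + s ^+ 2 + 2 * r * s * cos (b - p).
pose D := [set b | sin (b - p) != 0].
have G0 b : D b -> 0 < G b.
  rewrite /D/G/= => sb.
  have c1 : 0 < 1 + cos (b - p).
    rewrite lt_neqAle -lerBlDl sub0r cos_geN1 andbT eq_sym.
    apply: contra_neq sb => cb.
    apply/eqP; rewrite -sqrf_eq0 sin2cos2 (_ : cos _ = -1); last by lra.
    by rewrite sqrrN expr1n subrr.
  have : 0 < r * s * (1 + cos (b - p)) by rewrite !mulr_gt0.
  have := sqr_ge0 (r - s); nra.
have dG (b : R) : is_derive b 1 G (2 * r * s * - sin (b - p)).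
  have h := is_derive_cosB p b.
  by apply: is_derive_eq; rewrite add0r mul1r.
have cG (b : R) : {for b, continuous G}.
  apply: cvgD; first exact: cvg_cst.
  apply: cvgM; first exact: cvg_cst.
  exact: continuous_cosB.
have := @negligible_preimage_C1 _ (Num.sqrt \o G) (fun b =>
  (2 * Num.sqrt (G b))^-1 * (2 * r * s * - sin (b - p))) D B _ B0.
move=> H; apply: (negligibleS _ (negligibleU (negligible_sin0 p) (H _))).
  by move=> b Bb; have [|/eqP] := pselect (sin (b - p) = 0); [left|right].
move=> b Db; split.
- have sG : Num.sqrt (G b) != 0 by rewrite gt_eqF// sqrtr_gt0; exact: G0.
  apply: mulf_neq0; first by rewrite invr_neq0// mulf_neq0.
  by rewrite !mulf_neq0// ?oppr_eq0// gt_eqF.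
- apply: cvgM.
    apply: cvgV; first by rewrite mulf_neq0// gt_eqF// sqrtr_gt0; exact: G0.
    apply: cvgM; first exact: cvg_cst.
    by apply: (@continuous_comp _ _ _ G Num.sqrt) => //; exact: sqrt_continuous.
  apply: cvgM; first exact: cvg_cst.
  by apply: cvgN; exact: continuous_sinB.
- have H0 := cvgr_gt (G b) (cG b) 0 (G0 _ Db).
  near=> y; have Gy : 0 < G y by near: y; exact: H0.
  exact: (@is_derive1_comp _ Num.sqrt G _ _ _ (is_derive1_sqrt Gy) (dG y)).
Unshelve. all: by end_near. Qed.

End trigonometric_preimages.

(** * Almost everywhere statements *)

Section almost_everywhere.
Context d (T : measurableType d) (R : realType) (m : {measure set T -> \bar R}).
Implicit Types P Q S : T -> Prop.

(** filterS and filterS2 with the measure fixed beforehand, which spares the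
    search for a filter structure on aliases of the real line. *)
Lemma ae_imply P Q : (forall x, P x -> Q x) ->
  {ae m, forall x, P x} -> {ae m, forall x, Q x}.
Proof. by move=> PQ; apply: filterS. Qed.

Lemma ae_imply2 P Q S : (forall x, P x -> Q x -> S x) ->
  {ae m, forall x, P x} -> {ae m, forall x, Q x} -> {ae m, forall x, S x}.
Proof. by move=> PQS; apply: filterS2. Qed.

End almost_everywhere.

Lemma ge0_integral_ae0 d (T : measurableType d) (R : realType)
    (m : {measure set T -> \bar R}) (f : T -> \bar R) :
  measurable_fun setT f -> (forall x, 0 <= f x)%E ->
  {ae m, forall x, f x = 0%E} -> (\int[m]_x f x = 0)%E.
Proof.
move=> mf f0 fae.
have := ae_eq_integral_abs m measurableT mf.
rewrite (eq_integral f); last by move=> x _; rewrite /= gee0_abs.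
by move=> [_]; apply; apply: ae_imply fae => x ->.
Qed.

Lemma ae_eq_measure d (T : measurableType d) (R : realType)
    (m : {measure set T -> \bar R}) (A B : set T) :
  measurable A -> measurable B -> {ae m, forall w, A w <-> B w} -> m A = m B.
Proof.
move=> mA mB [C [mC C0 sC]].
have h (X Y : set T) : measurable X -> measurable Y ->
    (forall w, ~ C w -> X w -> Y w) -> (m X <= m Y)%E.
  move=> mX mY XY; rewrite -[leRHS]adde0 -C0.
  apply: le_trans (measureU2 _ _ _) => //; apply: le_measure; rewrite ?inE//.
    exact: measurableU.
  by move=> w Xw; have [Cw|Cw] := pselect (C w); [right|left; exact: XY].
have AB w : ~ C w -> (A w <-> B w).
  by move=> Cw; apply: contrapT => nAB; apply: Cw; exact: sC.
by apply/eqP; rewrite eq_le; apply/andP; split; apply: h => // w /AB [].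
Qed.

Lemma ae_forall_ord d (T : measurableType d) (R : realType)
    (m : {measure set T -> \bar R}) n (Q : 'I_n -> T -> Prop) :
  (forall i, {ae m, forall w, Q i w}) -> {ae m, forall w, forall i, Q i w}.
Proof.
move=> H; have : {ae m, forall w, forall k, forall i : 'I_n, val i = k -> Q i w}.
  apply: ae_foralln => k; have [kn|nk] := ltnP k n.
    apply: ae_imply (H (Ordinal kn)) => w Qw i ik.
    by rewrite (_ : i = Ordinal kn)//; exact: val_inj.
  by apply: aeW => w i ik; move: nk; rewrite -ik leqNgt ltn_ord.
by apply: ae_imply => w Qw i; exact: (Qw i).
Qed.

(** * Null sets of the plane in polar coordinates *)

Section null_sections.
Context d1 d2 (T1 : measurableType d1) (T2 : measurableType d2) (R : realType).
Variables (m1 : {sigma_finite_measure set T1 -> \bar R})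
          (m2 : {sigma_finite_measure set T2 -> \bar R}).
Variable C : set (T1 * T2).
Hypothesis mC : measurable C.

Lemma product_measure1_eq0 :
  (m1 \x m2)%E C = 0%E <-> {ae m1, forall x, m2 (xsection C x) = 0%E}.
Proof.
have mf : measurable_fun setT (m2 \o xsection C).
  by apply: measurable_fun_xsection.
have := ae_eq_integral_abs m1 measurableT mf.
rewrite (eq_integral (m2 \o xsection C)); last first.
  by move=> x _; rewrite /= gee0_abs.
move=> H; split.
- by move=> /H; apply: filterS => x /=; apply.
- by move=> h; apply/H; apply: filterS h => x /= ->.
Qed.

Lemma product_measure2_eq0 :
  (m1 \x m2)%E C = 0%E <-> {ae m2, forall y, m1 (ysection C y) = 0%E}.
Proof.
have -> : (m1 \x m2)%E C = (m1 \x^ m2)%E C.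
  apply: product_measure_unique => // A B mA mB.
  exact: product_measure2E.
have mf : measurable_fun setT (m1 \o ysection C).
  by apply: measurable_fun_ysection.
have := ae_eq_integral_abs m2 measurableT mf.
rewrite (eq_integral (m1 \o ysection C)); last first.
  by move=> x _; rewrite /= gee0_abs.
move=> H; split.
- by move=> /H; apply: filterS => x /=; apply.
- by move=> h; apply/H; apply: filterS h => x /= ->.
Qed.

End null_sections.

Section polar_null.
Context {R : realType}.
Local Notation mu := (@lebesgue_measure R).

(** Polar coordinates without a change of variables in the plane. The map
    (r, a) |-> (r cos a, r sin a) factors through
    (r, a) |-> (r cos a, tan a) and (x, m) |-> (x, m x). With one coordinate
    fixed, each step is a map of the line under which preimages of null sets are
    null, and Fubini's theorem exchanges the fixed coordinate. *)
Lemma polar_null_sections (A : set (R * R)) : measurable A ->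
  (mu \x mu)%E A = 0%E ->
  {ae mu, forall r, mu [set a | A (polar (r, a))] = 0%E}.
Proof.
move=> mA A0.
pose S := [set z : R * R | A (z.1, z.2 * z.1)].
have mS : measurable S.
  rewrite (_ : S = (fun z => (z.1, z.2 * z.1)) @^-1` A)// -[X in measurable X]setTI.
  have : measurable_fun setT (fun z : R * R => (z.1, z.2 * z.1)).
    by apply: measurable_fun_pair => //; exact: measurable_funM.
  exact.
have S0 : (mu \x mu)%E S = 0%E.
  apply/product_measure1_eq0 => //.
  have /product_measure1_eq0 -/(_ mA) := A0.
  have n0 : {ae mu, forall x, x != 0}.
    exists [set 0]; split => //; first exact: lebesgue_measure_set1.
    by move=> x /= /negP; rewrite negbK => /eqP.
  move: n0; apply: ae_imply2 => x x0 /(negligibleP mu (measurable_xsection _ mA)) Ax0.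
  apply/(negligibleP mu (measurable_xsection _ mS)).
  apply: (negligibleS _ (negligible_preimage_mulr x0 Ax0)) => m /=.
  by rewrite /xsection/= !inE.
have mE : measurable (@polar R @^-1` A : set (R * R)).
  by rewrite -[X in measurable X]setTI; exact: measurable_polar.
suff : {ae mu, forall r, mu (xsection (@polar R @^-1` A) r) = 0%E}.
  apply: ae_imply => r; rewrite (_ : [set _ | _] = xsection (@polar R @^-1` A) r)//.
  by apply/seteqP; split => a; rewrite /xsection/= inE.
apply/product_measure1_eq0 => //; apply/product_measure2_eq0 => //.
have /product_measure2_eq0 -/(_ mS) SM := S0.
have := negligible_preimage_tan SM.
move=> /(negligibleU negligible_cos0).
apply: negligibleS => a /= E0.
have [ca|/eqP ca] := pselect (cos a = 0); [by left|right].
split=> //; apply: contra_not E0 => Sa.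
apply/(negligibleP mu (measurable_ysection _ mE)).
move: Sa => /(negligibleP mu (measurable_ysection _ mS)) Sa.
apply: (negligibleS _ (negligible_preimage_mulr ca Sa)) => r /=.
rewrite /ysection/= !inE/S/polar/= /tan.
by rewrite (_ : sin a / cos a * _ = r * sin a)//; field.
Qed.

End polar_null.

(** * Rotations and the uniform angle *)

Section uniform_angle_lemmas.
Context {R : realType}.
Local Notation mu := (@lebesgue_measure R).

Lemma lebesgue_measure_translation (c : R) (A : set R) : measurable A ->
  mu ((fun x => x + c) @^-1` A) = mu A.
Proof.
have mc : measurable_fun setT (fun x : R => x + c) by exact: measurable_funD.
move=> mA; apply/esym.
have := @lebesgue_measure_unique _
  (pushforward mu (fun x : R => x + c : measurableTypeR R)).
apply => // _ [[a b]] _ <-.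
transitivity (mu `]a - c, b - c]%classic); last first.
  rewrite /pushforward; congr (mu _).
  by apply/seteqP; split => x/=; rewrite !in_itv/=; lra.
rewrite /= !lebesgue_measure_itv/= !lte_fin ltrD2r; case: ifPn => // _.
by rewrite -!EFinB; congr (_%:E); ring.
Qed.

Lemma uniform_angleE (D : set R) : measurable D ->
  uniform_angle D = (((2 * pi : R)^-1)%:E * mu (D `&` `](0 : R)%R, (2 * pi)%R]))%E.
Proof.
move=> mD; rewrite /uniform_angle /uniform_prob integral_uniform_pdf.
rewrite (eq_integral (fun=> ((2 * pi : R)^-1)%:E)); last first.
  by move=> x; rewrite inE/= in_itv/= /uniform_pdf subr0 => -[_ ->].
rewrite integral_cst/=; last exact: measurableI.
congr (_ * _)%E; apply/eqP; rewrite eq_le; apply/andP; split; last first.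
  apply: le_measure; rewrite ?inE; [exact: measurableI|exact: measurableI|].
  by apply: setIS; exact: subset_itv_oc_cc.
rewrite -[leRHS]adde0 -[X in (_ + X)%E](lebesgue_measure_set1 (0 : R)).
apply: le_trans (measureU2 _ _ _) => //; last exact: measurableI.
apply: le_measure; rewrite ?inE; [exact: measurableI| |].
  by apply: measurableU => //; exact: measurableI.
move=> x [Dx /=]; rewrite !in_itv/= => /andP[x0 x2].
have [->|xn] := eqVneq x 0; [by right|left; split => //].
by rewrite x2 lt_neqAle eq_sym xn x0.
Qed.

(** Translation by c moves the window ]0, 2 pi] to ]c, c + 2 pi]; periodicity
    brings the part beyond 2 pi back to ]0, c]. *)
Lemma uniform_angle_rotation (c : R) (D : set R) : measurable D ->
  0 <= c <= 2 * pi -> (forall x, D (x + 2 * pi) <-> D x) ->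
  uniform_angle ((fun x => x + c) @^-1` D) = uniform_angle D.
Proof.
move=> mD /andP[c0 c2] Dp.
have mt k : measurable_fun setT (fun x : R => x + k) by exact: measurable_funD.
have mI (i : interval R) : measurable (D `&` [set` i]) by exact: measurableI.
rewrite !uniform_angleE//; last by rewrite -[X in measurable X]setTI; exact: mt.
congr (_ * _)%E.
transitivity (mu (D `&` `]c, c + 2 * pi])).
  rewrite -(lebesgue_measure_translation c (mI _)); congr (mu _).
  by apply/seteqP; split => x /= [? ]; rewrite !in_itv/= => ?; split => //;
    rewrite ?in_itv/=; lra.
have -> : D `&` `]c, c + 2 * pi] =
    (D `&` `]c, 2 * pi]) `|` (D `&` `]2 * pi, c + 2 * pi]).
  rewrite -setIUr; congr (_ `&` _); apply/seteqP; split => x /=; rewrite !in_itv/=.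
    by have [?|?] := leP x (2 * pi); [left|right]; lra.
  by move=> []; lra.
have -> : D `&` `]0, 2 * pi] = (D `&` `]c, 2 * pi]) `|` (D `&` `]0, c]).
  rewrite -setIUr; congr (_ `&` _); apply/seteqP; split => x /=; rewrite !in_itv/=.
    by have [?|?] := leP x c; [right|left]; lra.
  by move=> []; lra.
have disj (a b c' d' : R) : b <= c' \/ d' <= a ->
    D `&` `]a, b]%classic `&` (D `&` `]c', d']%classic) = set0.
  move=> h; apply/seteqP; split => x //= [[_ +] [_]]; rewrite /= !in_itv/=.
  by case: h; lra.
have mU (a b c' d' : R) : b <= c' \/ d' <= a ->
    mu ((D `&` `]a, b]) `|` (D `&` `]c', d'])) =
    (mu (D `&` `]a, b]) + mu (D `&` `]c', d']))%E.
  by move=> h; apply: measureU; [exact: mI|exact: mI|exact: disj].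
rewrite (mU _ _ _ _ (or_introl (lexx _))) (mU _ _ _ _ (or_intror (lexx _))).
congr (_ + _)%E.
rewrite -(lebesgue_measure_translation (2 * pi) (mI _)); congr (mu _).
apply/seteqP; split => x /=; rewrite !in_itv/= => -[/Dp ? ?]; split => //.
  by lra.
by lra.
Qed.

End uniform_angle_lemmas.

Section rotations.
Context {R : realType}.
Local Notation U := (@uniform_angle R).

Definition rot (a : R) (z : R * R) : R * R :=
  (z.1 * cos a - z.2 * sin a, z.1 * sin a + z.2 * cos a).

Definition modulus (z : R * R) : R := Num.sqrt (z.1 ^+ 2 + z.2 ^+ 2).

Lemma rot_polar (a r t : R) : rot a (polar (r, t)) = polar (r, t + a).
Proof. by rewrite /rot/polar/= cosD sinD; congr pair; ring. Qed.

Lemma measurable_rot2 : measurable_fun setT (fun p : (R * R) * R => rot p.2 p.1).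
Proof.
have m1 : measurable_fun setT (fun p : (R * R) * R => p.1.1) by exact: measurableT_comp.
have m2 : measurable_fun setT (fun p : (R * R) * R => p.1.2) by exact: measurableT_comp.
have mc : measurable_fun setT (fun p : (R * R) * R => cos p.2).
  apply: measurableT_comp => //.
  by apply: continuous_measurable_fun; exact: continuous_cos.
have ms : measurable_fun setT (fun p : (R * R) * R => sin p.2).
  apply: measurableT_comp => //.
  by apply: continuous_measurable_fun; exact: continuous_sin.
apply: measurable_fun_pair => /=.
- by apply: measurable_funB; exact: measurable_funM.
- by apply: measurable_funD; exact: measurable_funM.
Qed.

Lemma measurable_rot (a : R) : measurable_fun setT (rot a).
Proof. exact: (measurableT_comp measurable_rot2 (pair2_measurable a)). Qed.

Lemma measurable_modulus : measurable_fun setT modulus.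
Proof.
apply: measurableT_comp.
  by apply: continuous_measurable_fun; exact: sqrt_continuous.
by apply: measurable_funD; apply: measurable_funX.
Qed.

Lemma modulus_gt0 z : (0 < modulus z) = (z != 0).
Proof.
rewrite /modulus sqrtr_gt0 lt_neqAle addr_ge0 ?sqr_ge0// andbT eq_sym.
by rewrite paddr_eq0 ?sqr_ge0// !sqrf_eq0; case: z => a b; rewrite xpair_eqE.
Qed.

Lemma polar_coordinates z : exists t, z = polar (modulus z, t).
Proof.
have [->|z0] := eqVneq z 0.
  by exists 0; rewrite /modulus/polar/= expr0n/= addr0 sqrtr0 !mul0r.
have m0 : 0 < modulus z by rewrite modulus_gt0.
have m2 : modulus z ^+ 2 = z.1 ^+ 2 + z.2 ^+ 2.
  by rewrite sqr_sqrtr// addr_ge0 ?sqr_ge0.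
pose x := z.1 / modulus z; pose y := z.2 / modulus z.
have xy : x ^+ 2 + y ^+ 2 = 1.
  rewrite /x/y !expr_div_n -mulrDl -m2 divff// expf_neq0// gt_eqF//.
have x1 : -1 <= x <= 1 by have := sqr_ge0 y; nra.
have ysin : `|y| = sin (acos x).
  by rewrite sin_acos// -sqrtr_sqr; congr Num.sqrt; lra.
have zx : z.1 = modulus z * x by rewrite /x mulrC divfK// gt_eqF.
have zy : z.2 = modulus z * y by rewrite /y mulrC divfK// gt_eqF.
have [y0|y0] := leP 0 y.
- exists (acos x); rewrite /polar/= acosK// -ysin ger0_norm// -zx -zy.
  by case: (z).
- exists (- acos x); rewrite /polar/= cosN sinN acosK// -ysin ltr0_norm// opprK -zx -zy.
  by case: (z).
Qed.

Lemma modulus_polarD (r s t b : R) :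
  modulus (polar (r, t) + polar (s, b)) =
  Num.sqrt (r ^+ 2 + s ^+ 2 + 2 * r * s * cos (b - t)).
Proof.
rewrite /modulus/polar/=; congr Num.sqrt; rewrite cosB.
transitivity (r ^+ 2 * (cos t ^+ 2 + sin t ^+ 2) +
  s ^+ 2 * (cos b ^+ 2 + sin b ^+ 2) +
  2 * r * s * (cos b * cos t + sin b * sin t)); first by ring.
by rewrite !cos2Dsin2 !mulr1.
Qed.

Lemma polar_2pi r t : polar (r, t + 2 * pi) = polar (r, t) :> R * R.
Proof. by rewrite /polar/= mulr_natl cosD2pi sinD2pi. Qed.

Lemma polar_periodic (A : set (R * R)) r (k : int) t :
  A (polar (r, t + 2 * pi * k%:~R)) <-> A (polar (r, t)).
Proof.
suff H (n : nat) t' : polar (r, t' + 2 * pi * n%:R) = polar (r, t') :> R * R.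
  case: k => n; first by rewrite -pmulrn H.
  rewrite NegzE mulrNz mulrN.
  by rewrite -[X in _ <-> A (polar (r, X))](subrK (2 * pi * n.+1%:R)) H.
elim: n t' => [|n IH] t'; first by rewrite mulr0 addr0.
by rewrite -[n.+1%:R]natr1 mulrDr mulr1 addrA polar_2pi IH.
Qed.

Lemma measurable_polar_section (A : set (R * R)) r : measurable A ->
  measurable [set a | A (polar (r, a))].
Proof.
move=> mA; have := measurableT_comp (@measurable_polar R) (pair1_measurable r).
by move=> /(_ measurableT _ mA); rewrite setTI.
Qed.

Lemma uniform_angle_polar (A : set (R * R)) r (c : R) : measurable A ->
  U [set a | A (polar (r, a + c))] = U [set a | A (polar (r, a))].
Proof.
move=> mA.
have p0 : 0 < 2 * pi :> R by rewrite mulr_gt0// pi_gt0.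
(* Reduce c modulo 2 pi to the range where the shift is already known to
   preserve the uniform angle. *)
pose k := Num.floor (c / (2 * pi)).
pose c' := c - 2 * pi * k%:~R.
have c'b : 0 <= c' <= 2 * pi.
  have := floor_le (c / (2 * pi)); have := ltW (lt_succ_floor (c / (2 * pi))).
  rewrite -/k ler_pdivrMr// ler_pdivlMr// /c' intrD; lra.
rewrite -[RHS](@uniform_angle_rotation _ c')//; last 2 first.
- exact: measurable_polar_section.
- by move=> x /=; rewrite polar_2pi.
congr (U _); apply/seteqP; split => a /=.
- by rewrite (_ : a + c = a + c' + 2 * pi * k%:~R) ?polar_periodic// /c'; ring.
- rewrite (_ : a + c = a + c' + 2 * pi * k%:~R); last by rewrite /c'; ring.
  by rewrite polar_periodic.
Qed.

(** In polar coordinates a rotation only shifts the angle. *)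
Lemma uniform_angle_rot (A : set (R * R)) z : measurable A ->
  U [set a | A (rot a z)] = U [set a | A (polar (modulus z, a))].
Proof.
move=> mA; have [t zt] := polar_coordinates z.
rewrite {1}zt -[RHS](uniform_angle_polar _ t mA); congr (U _).
by apply/seteqP; split => a /=; rewrite rot_polar addrC.
Qed.

End rotations.

(** * Rotation-invariant laws *)

Section rotation_invariance.
Context {R : realType}.
Local Notation U := (@uniform_angle R).
Local Notation mu := (@lebesgue_measure R).

Lemma measurable_set1_pair (u : R * R) : measurable [set u].
Proof.
rewrite (_ : [set u] = [set u.1] `*` [set u.2]); first exact: measurableX.
by apply/seteqP; split => [z -> //|[z1 z2] /= [-> ->]]; case: u.
Qed.

Definition rotation_invariant (m : set (R * R) -> \bar R) :=
  forall a A, measurable A -> m (rot a @^-1` A) = m A.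

Lemma measurable_preimage_rot (a : R) (A : set (R * R)) :
  measurable A -> measurable (rot a @^-1` A).
Proof. by move=> mA; rewrite -[X in measurable X]setTI; exact: measurable_rot. Qed.

Lemma measurable_preimage_polar (A : set (R * R)) :
  measurable A -> measurable (@polar R @^-1` A).
Proof. by move=> mA; rewrite -[X in measurable X]setTI; exact: measurable_polar. Qed.

Lemma polar_measure_rotation_invariant (nu : {measure set R -> \bar R}) :
  rotation_invariant (polar_measure nu).
Proof.
move=> a A mA; rewrite /polar_measure /pushforward /product_measure1.
apply: eq_integral => r _ /=; rewrite !xsectionE -[RHS](uniform_angle_polar r a mA).
by congr (uniform_angle _); apply/seteqP; split => t; rewrite /preimage/= rot_polar.
Qed.

Lemma measurable_angular_measure (A : set (R * R)) : measurable A ->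
  measurable_fun setT (fun r => U [set a | A (polar (r, a))]).
Proof.
move=> mA; have := measurable_fun_xsection U (measurable_preimage_polar mA).
rewrite (_ : (fun _ => _) = U \o xsection (@polar R @^-1` A))//.
by apply/funext => r /=; rewrite xsectionE.
Qed.

(** Averaging the invariance over a uniform angle and exchanging the integrals
    exhibits m as a mixture of uniform laws on circles centred at 0. *)
Lemma rotation_invariantE (m : probability (R * R)%type R) (A : set (R * R)) :
  rotation_invariant m -> measurable A ->
  m A = (\int[m]_z U [set a | A (polar (modulus z, a))])%E.
Proof.
move=> rm mA.
pose E : set ((R * R) * R) := [set p | A (rot p.2 p.1)].
have mE : measurable E.
  by rewrite -[X in measurable X]setTI; exact: (measurable_rot2 measurableT mA).
transitivity ((m \x U)%E E); last first.
  apply: eq_integral => z _ /=.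
  by rewrite -(uniform_angle_rot z mA) xsectionE.
have -> : (m \x U)%E E = (m \x^ U)%E E.
  by apply: product_measure_unique => // B C mB mC; exact: product_measure2E.
transitivity (\int[U]_a m A)%E.
  by rewrite integral_cst// [X in (_ * X)%E](@probability_setT _ _ _ U) mule1.
by apply: eq_integral => a _ /=; rewrite ysectionE -[LHS](rm a).
Qed.

Lemma uniform_angle_eq0 (D : set R) : measurable D -> mu.-negligible D -> U D = 0%E.
Proof.
move=> mD /(negligibleP mu mD) D0.
by have /null_content_dominatesP := dominates_uniform_prob (@zero_lt_2pi R); apply.
Qed.

(** Two angles of the same point differ by a zero of the sine. *)
Lemma uniform_angle_point (r : R) (u : R * R) : u != 0 ->
  U [set a | polar (r, a) = u] = 0%E.
Proof.
move=> u0.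
have m1 := measurable_set1_pair u.
apply: uniform_angle_eq0; first exact: (measurable_polar_section r m1).
have [->|/set0P[b /= bu]] := eqVneq [set a | polar (r, a) = u] set0.
  exact: negligible_set0.
apply: (negligibleS _ (negligible_sin0 b)) => a /= au.
have r0 : r != 0.
  by apply: contra_neq u0 => r0; rewrite -bu /polar/= r0 !mul0r.
move: au; rewrite -bu /polar/= => -[/(mulfI r0) ca /(mulfI r0) sa].
by rewrite sinB ca sa mulrC subrr.
Qed.

Lemma rotation_invariant_point (m : probability (R * R)%type R) (u : R * R) :
  rotation_invariant m -> u != 0 -> m [set u] = 0%E.
Proof.
move=> rm u0; rewrite rotation_invariantE//; last first.
  exact: measurable_set1_pair.
by under eq_integral do rewrite uniform_angle_point//; rewrite integral0.
Qed.

Variables m1 m2 : probability (R * R)%type R.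
Hypothesis rm2 : rotation_invariant m2.

Lemma measurable_fun_add2 :
  measurable_fun setT (fun p : (R * R) * (R * R) => p.1 + p.2).
Proof.
have h (f : R * R -> R) : measurable_fun setT f ->
  measurable_fun setT (fun p : (R * R) * (R * R) => f p.1) /\
  measurable_fun setT (fun p : (R * R) * (R * R) => f p.2).
  by move=> mf; split; exact: measurableT_comp.
have [h11 h12] := h fst measurable_fst; have [h21 h22] := h snd measurable_snd.
by apply: measurable_fun_pair; exact: measurable_funD.
Qed.

(** Once p.1 = u is known and nonzero, p.2 has to be the single point - u, to
    which m2 gives no mass. *)
Lemma opposite_pair_null :
  (m1 \x m2)%E [set p | p.1 + p.2 = 0 /\ p.1 != 0] = 0%E.
Proof.
rewrite /product_measure1 integral0_eq// => u _ /=.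
have [->|u0] := eqVneq u 0.
  rewrite (_ : xsection _ _ = set0) ?measure0// xsectionE.
  by apply/seteqP; split => // v /= [_]; rewrite eqxx.
rewrite (_ : xsection _ _ = [set - u]).
  by rewrite rotation_invariant_point// oppr_eq0.
rewrite xsectionE; apply/seteqP; split => v /=.
  by move=> [/eqP + _]; rewrite addrC addr_eq0 => /eqP.
by move=> ->; rewrite subrr.
Qed.

Lemma measurable_preimage_modulus_add (B : set R) : measurable B ->
  measurable [set p : (R * R) * (R * R) | B (modulus (p.1 + p.2))].
Proof.
move=> mB; have := measurableT_comp measurable_modulus measurable_fun_add2.
by move=> /(_ measurableT _ mB); rewrite setTI.
Qed.

Lemma ae_neq0 (m : probability (R * R)%type R) :
  m [set 0] = 0%E -> {ae m, forall z : R * R, z != 0}.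
Proof.
move=> m0; exists [set 0]; split => //; first exact: measurable_set1_pair.
by move=> z /= /negP; rewrite negbK => /eqP.
Qed.

Hypotheses (m10 : m1 [set 0] = 0%E) (m20 : m2 [set 0] = 0%E).

(** The second vector may be turned by a uniform angle; the length of the sum is
    then given by the law of cosines. *)
Lemma modulus_sum_null (B : set R) : measurable B -> mu B = 0%E ->
  (m1 \x m2)%E [set p | B (modulus (p.1 + p.2))] = 0%E.
Proof.
move=> mB B0.
have mG : measurable (@modulus R @^-1` B).
  by rewrite -[X in measurable X]setTI; exact: measurable_modulus.
have mGu (u : R * R) : measurable [set v : R * R | B (modulus (u + v))].
  have := measurableT_comp measurable_fun_add2 (pair1_measurable u).
  by move=> /(_ measurableT _ mG); rewrite setTI.
transitivity (\int[m1]_u m2 [set v : R * R | B (modulus (u + v)%R)])%E.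
  by apply: eq_integral => u _ /=; rewrite xsectionE.
have H (u : R * R) : u != 0 -> m2 [set v : R * R | B (modulus (u + v)%R)] = 0%E.
  move=> u0; rewrite rotation_invariantE//; apply: ge0_integral_ae0.
  - exact: (measurableT_comp (measurable_angular_measure (mGu u)) measurable_modulus).
  - by [].
  - apply: (ae_imply _ (ae_neq0 m20)) => v v0.
    apply: uniform_angle_eq0; first exact: (measurable_polar_section _ (mGu u)).
    have [t ut] := polar_coordinates u.
    move: B0 => /(negligibleP mu mB) B0.
    have um : 0 < modulus u by rewrite modulus_gt0.
    have vm : 0 < modulus v by rewrite modulus_gt0.
    apply: (negligibleS _ (negligible_preimage_law_of_cosines t um vm B0)).
    by move=> b /=; rewrite {1}ut modulus_polarD.
apply: ge0_integral_ae0 => //.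
- have := measurable_fun_xsection m2 (measurable_preimage_modulus_add mB).
  rewrite (_ : (fun _ => _) = m2 \o xsection [set p | B (modulus (p.1 + p.2))])//.
  by apply/funext => u /=; rewrite xsectionE.
- by apply: (ae_imply _ (ae_neq0 m10)) => u u0; exact: H.
Qed.

(** By invariance, m A is the mean over z of the angular measure of A on the
    circle through z. This vanishes unless the radius belongs to a null set
    (polar_null_sections), which the length of the sum of two independent vectors
    avoids (modulus_sum_null). *)
Lemma sum_dominated (m : probability (R * R)%type R) (A : set (R * R)) :
  rotation_invariant m ->
  (forall B, measurable B -> m B = (m1 \x m2)%E [set p | B (p.1 + p.2)]) ->
  measurable A -> (mu \x mu)%E A = 0%E -> m A = 0%E.
Proof.
move=> rm msum mA A0.
pose H r := U [set a | A (polar (r, a))].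
have mH : measurable_fun setT H by exact: measurable_angular_measure.
pose B := [set r | H r != 0%E].
have mB : measurable B.
  by have := emeasurable_neq measurableT mH 0%E; rewrite setTI.
have B0 : mu B = 0%E.
  apply/negligibleP => //.
  apply: (negligibleS _ (polar_null_sections mA A0)) => r /= Hr0 Ar.
  move: Hr0 => /eqP; apply; apply: uniform_angle_eq0.
    exact: measurable_polar_section.
  by apply/negligibleP => //; exact: measurable_polar_section.
rewrite rotation_invariantE//; apply: ge0_integral_ae0 => //.
  exact: (measurableT_comp mH measurable_modulus).
exists (@modulus R @^-1` B); split.
- by rewrite -[X in measurable X]setTI; exact: measurable_modulus.
- rewrite /= msum; first exact: modulus_sum_null.
  by rewrite -[X in measurable X]setTI; exact: measurable_modulus.
- by move=> z /=; move/eqP.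
Qed.

End rotation_invariance.

(** * Integrals of finite-range functions against a Poisson measure *)

Section poisson_counts.
Context d (T : measurableType d) (R : realType) (P : probability T R).
Context d' (E : measurableType d') (N : T -> {measure set E -> \bar R})
  (mu : {measure set E -> \bar R}).
Hypothesis prmN : poisson_random_measure P N mu.

Let mcount B (x : \bar R) : measurable B -> measurable [set w | N w B = x].
Proof.
move=> mB; have := prm_measurable prmN mB measurableT (emeasurable_set1 x).
by rewrite setTI.
Qed.

Lemma prm_count_law B B' (k : nat) : measurable B -> measurable B' ->
  mu B = mu B' -> (mu B < +oo)%E ->
  P [set w | N w B = k%:R%:E] = P [set w | N w B' = k%:R%:E].
Proof.
move=> mB mB' BB' Boo.
have := prm_poisson prmN mB; have := prm_poisson prmN mB'; rewrite -BB'.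
have : (0 <= mu B)%E by [].
by case: (mu B) Boo => [r _ _ h1 h2|//|//]; rewrite [LHS](h2 k) [RHS](h1 k).
Qed.

Lemma prm_count_nat B : measurable B -> (mu B < +oo)%E ->
  {ae P, forall w, exists k : nat, N w B = k%:R%:E}.
Proof.
move=> mB Boo.
pose F k := [set w | N w B = k%:R%:E].
have mF k : measurable (F k) by exact: mcount.
have tF : trivIset setT F.
  apply/trivIsetP => i j _ _ ij; apply/seteqP; split => // w [/= Ni Nj].
  by move: Nj; rewrite /F/= Ni => -[/eqP]; rewrite eqr_nat (negbTE ij).
have PF : P (\bigcup_k F k) = 1%E.
  rewrite measure_bigcup//.
  have := prm_poisson prmN mB.
  have : (0 <= mu B)%E by [].
  case: (mu B) Boo => [r _ _ h|//|//].
  rewrite (eq_eseriesr (g := fun k => poisson_prob r 0 [set k])); last first.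
    by move=> k _; exact: h.
  have := @measure_bigcup _ _ _ (poisson_prob r 0) setT (fun k => [set k]).
  rewrite (_ : \bigcup_k [set k] = setT); last first.
    by apply/seteqP; split => // k _; exists k.
  move=> H; transitivity (poisson_prob r 0 setT); last exact: probability_setT.
  apply/esym/H => //.
  apply/trivIsetP => i j _ _ ij; apply/seteqP; split => // w [/= ->] /eqP.
  by rewrite (negbTE ij).
exists (~` \bigcup_k F k); split.
- by apply: measurableC; exact: bigcup_measurable.
- by rewrite probability_setC ?PF ?subee//; exact: bigcup_measurable.
- by move=> w /= h [k _ Fk]; apply: h; exists k.
Qed.

(** An event on the counts is a countable disjoint union of cells on which every
    count is prescribed, and independence gives the probability of a cell in
    terms of the intensities. *)
Lemma prm_counts_law n (B B' : 'I_n -> set E) (Q : ('I_n -> nat) -> Prop) :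
  (forall i, measurable (B i)) -> (forall i, measurable (B' i)) ->
  trivIset setT B -> trivIset setT B' ->
  (forall i, mu (B i) = mu (B' i)) -> (forall i, mu (B i) < +oo)%E ->
  let S B := [set w | exists2 k, Q k & forall i, N w (B i) = (k i)%:R%:E] in
  [/\ measurable (S B), measurable (S B') & P (S B) = P (S B')].
Proof.
move=> mB mB' tB tB' BB' Boo /=.
pose cell (C : 'I_n -> set E) (k : 'I_n -> nat) :=
  \bigcap_(i in setT) [set w | N w (C i) = (k i)%:R%:E].
(* pickle_inv, unlike unpickle, is injective where it is defined, so distinct
   indices give disjoint cells. *)
pose F C j := if pickle_inv j is Some k then
  (if `[< Q (fun_of_fin (k : {ffun 'I_n -> nat})) >] then cell C (fun_of_fin k)
   else set0) else set0.
have mcell C k : (forall i, measurable (C i)) -> measurable (cell C k).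
  by move=> mC; apply: fin_bigcap_measurable => // i _; exact: mcount.
have mF C j : (forall i, measurable (C i)) -> measurable (F C j).
  by move=> mC; rewrite /F; case: pickle_inv => // k; case: ifPn => // _; exact: mcell.
have SE C : [set w | exists2 k, Q k & forall i, N w (C i) = (k i)%:R%:E] =
    \bigcup_j F C j.
  apply/seteqP; split => w /=.
    move=> [k Qk kC]; pose k' := [ffun i => k i].
    have k'k : fun_of_fin k' = k by apply/funext => i; rewrite ffunE.
    exists (pickle k'); first exact: I.
    rewrite /F pickleK_inv k'k asboolT// => i _ /=; exact: kC.
  move=> [j _]; rewrite /F; case: pickle_inv => // k; case: ifPn => // /asboolP Qk kC.
  by exists (fun_of_fin k) => // i; exact: kC.
have tF C : trivIset setT (F C).
  apply/trivIsetP => i j _ _ ij; apply/seteqP; split => // w []; rewrite /F.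
  case: (pickle_inv i) (@pickle_invK {ffun 'I_n -> nat} i) => //= ki iE.
  case: (pickle_inv j) (@pickle_invK {ffun 'I_n -> nat} j) => //= kj jE.
  case: ifPn => // _ kiC; case: ifPn => // _ kjC.
  move: ij; rewrite -iE -jE => /eqP; apply; congr pickle; apply/ffunP => x.
  move: (kiC x I) (kjC x I) => /= -> [/eqP]; rewrite eqr_nat => /eqP //.
have Pcell k : P (cell B k) = P (cell B' k).
  have h C : (forall i, measurable (C i)) -> trivIset setT C ->
      P (cell C k) = (\prod_i P [set w | N w (C i) = (k i)%:R%:E])%E.
    move=> mC tC; have := prm_independent prmN mC tC.
    by move=> /(_ (fun i => [set (k i)%:R%:E])); apply => i; exact: emeasurable_set1.
  rewrite !h//; apply: eq_bigr => i _; exact: prm_count_law.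
rewrite !SE; split; [by apply: bigcup_measurable => j _; exact: mF..|].
rewrite !measure_bigcup//; [|by move=> j _; exact: mF..].
apply: eq_eseriesr => j _; rewrite /F; case: pickle_inv => [k|//].
by case: ifPn => _ //; exact: Pcell.
Qed.

End poisson_counts.

Section simple_integrals.
Context d (E : measurableType d) (R : realType).

Lemma integrable_indic_lty (m : {measure set E -> \bar R}) (B : set E) :
  measurable B -> (m B < +oo)%E -> m.-integrable setT (fun p => (\1_B p)%:E).
Proof.
move=> mB Boo; apply/integrableP; split; first exact/measurable_EFinP.
rewrite (eq_integral (fun p => (\1_B p)%:E)); last first.
  by move=> p _; rewrite gee0_abs// lee_fin.
by rewrite integral_indic// setIT.
Qed.

(** The sets are kept explicit because a Poisson measure is known through its
    counts of disjoint sets. *)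
Definition step n (v : 'I_n -> R) (B : 'I_n -> set E) (p : E) : R :=
  \sum_i v i * \1_(B i) p.

Lemma EFin_step n (v : 'I_n -> R) (B : 'I_n -> set E) :
  EFin \o step v B =
  fun p => (\sum_(i <- enum 'I_n) (v i)%:E * (\1_(B i) p)%:E)%E.
Proof.
apply/funext => p /=; rewrite /step -sumEFin big_enum/=.
by apply: eq_bigr => i _; rewrite EFinM.
Qed.

Lemma step_integrable (m : {measure set E -> \bar R}) n (v : 'I_n -> R)
    (B : 'I_n -> set E) :
  (forall i, measurable (B i)) -> (forall i, m (B i) < +oo)%E ->
  m.-integrable setT (EFin \o step v B).
Proof.
move=> mB Boo; rewrite EFin_step; apply: integrable_sum => // i _.
by apply: integrableZl => //; exact: integrable_indic_lty.
Qed.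

Lemma Rintegral_step (m : {measure set E -> \bar R}) n (v x : 'I_n -> R)
    (B : 'I_n -> set E) : (forall i, measurable (B i)) ->
  (forall i, m (B i) = (x i)%:E) ->
  \int[m]_p step v B p = \sum_i v i * x i.
Proof.
move=> mB mBx; rewrite /Rintegral.
have intB i : m.-integrable setT (fun p => (\1_(B i) p)%:E).
  by apply: integrable_indic_lty => //; rewrite mBx ltry.
have := EFin_step v B; rewrite /comp => ->.
rewrite integral_sum//; last first.
  by move=> i; have := integrableZl measurableT (v i) (intB i).
rewrite big_enum/= (eq_bigr (fun i => (v i * x i)%:E)) ?sumEFin// => i _.
by rewrite integralZl// integral_indic// setIT mBx.
Qed.

Lemma measurable_Rintegral d' (T : measurableType d')
    (N : T -> {measure set E -> \bar R}) (g : E -> R) :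
  (forall B, measurable B -> measurable_fun setT (fun w => N w B)) ->
  measurable_fun setT g -> measurable_fun setT (fun w => \int[N w]_p g p).
Proof.
move=> mN mg; have mEg : measurable_fun setT (EFin \o g) by exact/measurable_EFinP.
apply: measurableT_comp; first exact: fine_measurable.
under eq_fun do rewrite integralE.
apply: emeasurable_funB; apply: measurable_fun_integral_kernel => //.
- exact: measurable_funepos.
- exact: measurable_funeneg.
Qed.

(** The value 0 is left out: its fibre may have infinite measure. *)
Lemma finite_range_step (g : E -> R * R) : measurable_fun setT g ->
    finite_set (range g) ->
  exists (n : nat) (v : 'I_n -> R * R),
    [/\ injective v, forall i, v i != 0 &
      forall p, g p = (step (fun i => (v i).1) (fun i => g @^-1` [set v i]) p,
                       step (fun i => (v i).2) (fun i => g @^-1` [set v i]) p)].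
Proof.
move=> mg fg; pose s := [seq x <- finmap.enum_fset (fset_set (range g)) | x != 0].
have us : uniq s by rewrite filter_uniq// finmap.fset_uniq.
exists (size s), (fun i => s`_i); split.
- by move=> i j /eqP; rewrite nth_uniq// => /eqP/val_inj.
- by move=> i; have := mem_nth 0 (ltn_ord i); rewrite mem_filter => /andP[].
move=> p; rewrite /step.
have H (f : R * R -> R) : f 0 = 0 ->
    f (g p) = \sum_(i < size s) f s`_i * \1_(g @^-1` [set s`_i]) p.
  move=> f0; have [gs|gs] := boolP (g p \in s).
    have gi : (index (g p) s < size s)%N by rewrite index_mem.
    rewrite (bigD1 (Ordinal gi))//= nth_index// indicE mem_set//= mulr1.
    rewrite big1 ?addr0// => i ig; rewrite indicE memNset ?mulr0// => /= gpi.
    by move/eqP : ig; apply; apply/val_inj => /=; rewrite gpi index_uniq.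
  have -> : g p = 0.
    move: gs; rewrite mem_filter negb_and negbK => /orP[/eqP//|].
    by rewrite (_ : _ \in _ = true)//= in_fset_set//; apply: mem_set; exists p.
  rewrite f0 big1// => i _; rewrite indicE memNset ?mulr0// => /= gpi.
  by move: gs; rewrite gpi mem_nth.
by rewrite [LHS]surjective_pairing (H fst)// (H snd).
Qed.

End simple_integrals.

Section law_of_integrals.
Context d (T : measurableType d) (R : realType) (P : probability T R).
Context d' (E : measurableType d') (N : T -> {measure set E -> \bar R})
  (mu : {measure set E -> \bar R}).
Hypothesis prmN : poisson_random_measure P N mu.

Definition integral_pair (g : E -> R * R) (w : T) : R * R :=
  (\int[N w]_p (g p).1, \int[N w]_p (g p).2).

Lemma measurable_integral_pair (g : E -> R * R) : measurable_fun setT g ->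
  measurable_fun setT (integral_pair g).
Proof.
move=> mg; have mN := prm_measurable prmN.
by apply: measurable_fun_pair; apply: measurable_Rintegral => //;
  exact: measurableT_comp.
Qed.

(** Almost surely the pair of integrals is a fixed function of the counts of the
    nonzero fibres of g, and th preserves the intensity of these fibres. *)
Lemma integral_pair_law (g : E -> R * R) (th : E -> E) (A : set (R * R)) :
  measurable_fun setT g -> finite_set (range g) ->
  (forall v : R * R, v != 0%R -> (mu (g @^-1` [set v]) < +oo)%E) ->
  measurable_fun setT th ->
  (forall B, measurable B -> mu (th @^-1` B) = mu B) ->
  measurable A ->
  P (integral_pair g @^-1` A) = P (integral_pair (g \o th) @^-1` A).
Proof.
move=> mg fg goo mth muth mA.
have [n [v [injv v0 gE]]] := finite_range_step mg fg.
pose B i := g @^-1` [set v i]; pose B' i := th @^-1` (B i).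
have mB i : measurable (B i).
  rewrite /B -[X in measurable X]setTI; apply: mg => //; exact: measurable_set1_pair.
have mB' i : measurable (B' i).
  by rewrite /B' -[X in measurable X]setTI; exact: mth.
have tB : trivIset setT B.
  apply/trivIsetP => i j _ _ ij; apply/seteqP; split => // p [gi gj].
  by move: ij => /eqP; apply; apply: injv; rewrite -[LHS]gi -[RHS]gj.
have tB' : trivIset setT B'.
  apply/trivIsetP => i j _ _ ij; apply/seteqP; split => // p [gi gj].
  by move: ij => /eqP; apply; apply: injv; rewrite -[LHS]gi -[RHS]gj.
pose x (k : 'I_n -> nat) : R * R :=
  (\sum_i (v i).1 * (k i)%:R, \sum_i (v i).2 * (k i)%:R).
have Boo i : (mu (B i) < +oo)%E by exact: goo.
have BB' i : mu (B i) = mu (B' i) by rewrite muth.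
have [mS mS' SS'] := prm_counts_law prmN (A \o x) mB mB' tB tB' BB' Boo.
have key (h : E -> R * R) (C : 'I_n -> set E) : measurable_fun setT h ->
    (forall i, measurable (C i)) -> (forall i, mu (C i) < +oo)%E ->
    (forall p, h p = (step (fun i => (v i).1) C p, step (fun i => (v i).2) C p)) ->
    measurable [set w | exists2 k, (A \o x) k & forall i, N w (C i) = (k i)%:R%:E] ->
    P (integral_pair h @^-1` A) =
    P [set w | exists2 k, (A \o x) k & forall i, N w (C i) = (k i)%:R%:E].
  move=> mh mC Coo hE mSC.
  have mIA : measurable (integral_pair h @^-1` A).
    by rewrite -[X in measurable X]setTI; exact: measurable_integral_pair.
  apply: ae_eq_measure => //.
  have : {ae P, forall w, forall i, exists k : nat, N w (C i) = k%:R%:E}.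
    apply: ae_forall_ord => i; exact: (prm_count_nat prmN (mC i) (Coo i)).
  apply: ae_imply => w /choice[k Ck].
  have Ix : integral_pair h w = x k.
    rewrite /integral_pair /x; congr pair.
      rewrite -(Rintegral_step (fun i => (v i).1) mC Ck).
      by apply: eq_Rintegral => p _; rewrite hE.
    rewrite -(Rintegral_step (fun i => (v i).2) mC Ck).
    by apply: eq_Rintegral => p _; rewrite hE.
  rewrite /= Ix; split=> [Ax|[k' Ak' Ck']]; first by exists k.
  suff -> : k = k' by [].
  apply/funext => i; move: (Ck' i); rewrite Ck => -[/eqP].
  by rewrite eqr_nat => /eqP.
rewrite (key g B)// (key (g \o th) B')//.
- exact: measurableT_comp.
- by move=> i; rewrite -BB'.
- by move=> p; rewrite /= gE.
Qed.

End law_of_integrals.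

(** * Square-integrable approximation *)

Section truncation.
Context (R : realType).
Import HBNNSimple.

(** phi n x is A n x - A n (- x), where A n increases to the positive part and
    has finite range. *)
Lemma truncation_exists : exists phi : nat -> R -> R,
  [/\ forall n, measurable_fun setT (phi n), forall n, finite_set (range (phi n)),
      forall n x, `|phi n x| <= `|x| & forall x, phi n x @[n --> \oo] --> x].
Proof.
pose p (x : R) := Num.max x 0.
have mp : measurable_fun setT (EFin \o p).
  by apply/measurable_EFinP; exact: measurable_maxr.
have p0 (x : R) : setT x -> (0 <= (EFin \o p) x)%E.
  by move=> _; rewrite lee_fin /p le_max lexx orbT.
have ppos (x : R) : 0 <= x -> p x = x by exact: max_l.
have pneg (x : R) : x <= 0 -> p x = 0 by exact: max_r.
pose A := nnsfun_approx measurableT mp.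
have Acvg x : A n x @[n --> \oo] --> p x.
  have /= := @cvg_nnsfun_approx _ _ _ _ measurableT _ mp p0 x I.
  by move/fine_cvgP => [].
have Ale n x : A n x <= p x.
  have nd : nondecreasing_seq (A ^~ x).
    by move=> m k mk; have /lefP := nd_nnsfun_approx measurableT mp mk; apply.
  have := nondecreasing_cvgn_le nd (cvgP _ (Acvg x)) n.
  by rewrite (cvg_lim _ (Acvg x)).
exists (fun n x => A n x - A n (- x)); split.
- move=> n; apply: measurable_funB; first exact: measurable_funP.
  by have := measurableT_comp (@measurable_funP _ _ _ _ setT (A n))
    (@measurable_funN _ _ R setT id (@measurable_id _ _ setT)).
- move=> n; apply: (@sub_finite_set _ _
    [set x - y | x in range (A n) & y in range (A n)]).
    move=> _ [x _ <-]; exists (A n x); first by exists x.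
    by exists (A n (- x)) => //; exists (- x).
  by apply: finite_image2; exact: fimfunP.
- move=> n x.
  have A0 y : 0 <= A n y by exact: fun_ge0.
  have := Ale n x; have := Ale n (- x); have := A0 x; have := A0 (- x).
  have [x0|x0] := leP 0 x.
    rewrite (ppos x x0) (pneg (- x)); last by lra.
    by move=> h1 h2 h3 h4; rewrite (ger0_norm x0) ler_norml; lra.
  rewrite (pneg x (ltW x0)) (ppos (- x)); last by lra.
  by move=> h1 h2 h3 h4; rewrite (ltr0_norm x0) ler_norml; lra.
- move=> x; have xE : p x - p (- x) = x.
    have [x0|x0] := leP 0 x.
      by rewrite (ppos x x0) (pneg (- x)); lra.
    by rewrite (pneg x (ltW x0)) (ppos (- x)); lra.
  by rewrite -[X in _ --> X]xE; apply: (@cvgB _ R^o); exact: Acvg.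
Qed.

End truncation.

Lemma ge0_cvge0P (R : realType) (u : nat -> \bar R) : (forall n, 0 <= u n)%E ->
  u n @[n --> \oo] --> 0%E <->
  forall e : R, 0 < e -> \forall n \near \oo, (u n <= e%:E)%E.
Proof.
move=> u0; split=> [u_cvg e e0|H].
  have : nbhs (0%E : \bar R) [set y | (y < e%:E)%E].
    by apply: open_ereal_lt'; rewrite lte_fin.
  by move=> /u_cvg H; near=> n; apply/ltW; near: n; exact: H.
apply/fine_cvgP; split.
  near=> n; rewrite ge0_fin_numE//; apply: (@le_lt_trans _ _ 1%:E); last exact: ltry.
  by near: n; exact: H.
apply/cvgr0Pnorm_le => e e0.
have He := H e e0; near=> n; have une : (u n <= e%:E)%E by near: n; exact: He.
rewrite /= ger0_norm ?fine_ge0// -lee_fin fineK// ge0_fin_numE//.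
exact: le_lt_trans une (ltry _).
Unshelve. all: by end_near. Qed.

Section square_integrals.
Context d (T : measurableType d) (R : realType) (m : {measure set T -> \bar R}).
Implicit Types u f : T -> R.
Local Open Scope ereal_scope.

(** Limits are handled through squared norms, where
    (a + k b)^2 <= 2 a^2 + 2 k^2 b^2 replaces the triangle inequality. *)
Definition sqint u := \int[m]_x (u x ^+ 2)%:E.

Lemma sqint_ge0 u : 0 <= sqint u.
Proof. by apply: integral_ge0 => x _; rewrite lee_fin sqr_ge0. Qed.

Lemma LnormE2 u : Lnorm m 2%:E (EFin \o u) = sqint u `^ 2^-1.
Proof.
rewrite unlock; congr (_ `^ _); apply: eq_integral => x _ /=.
by rewrite powR_mulrn// -normrX ger0_norm// sqr_ge0.
Qed.

Lemma Lfun2P u : u \in Lfun m 2%:E <-> measurable_fun setT u /\ sqint u < +oo.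
Proof.
rewrite inE; split.
  move=> /andP[/[!inE]/= mu nu]; split => //.
  move: nu; rewrite /finite_norm LnormE2; apply: lty_poweRy => //.
move=> [mu su]; apply/andP; split; rewrite inE//=.
by rewrite /finite_norm LnormE2; exact: poweR_lty.
Qed.

Lemma Lnorm2_leP u (e : R) : (0 < e)%R ->
  Lnorm m 2%:E (EFin \o u) <= e%:E <-> sqint u <= (e ^+ 2)%:E.
Proof.
move=> e0; rewrite LnormE2.
have homo (x y : \bar R) (r : R) : (0 <= r)%R -> 0 <= x -> 0 <= y ->
    x <= y -> x `^ r <= y `^ r.
  by move=> r0 x0 y0; apply: gt0_ler_poweR => //; rewrite in_itv/= leey andbT.
have s0 := sqint_ge0 u.
split=> h.
- have := homo _ _ 2%R (ler0n _ 2) (poweR_ge0 _ _) (ltW e0 : 0 <= e%:E) h.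
  by rewrite -poweRrM mulVf ?pnatr_eq0// poweRe1// poweR_EFin powR_mulrn ?(ltW e0).
- have i2 : (0 <= 2^-1 :> R)%R by rewrite invr_ge0.
  have e20 : 0 <= (e ^+ 2)%:E by rewrite lee_fin sqr_ge0.
  have := homo _ _ 2^-1%R i2 s0 e20 h.
  rewrite [X in _ <= X]poweR_EFin -powR_mulrn ?(ltW e0)//.
  by rewrite -powRrM mulfV ?pnatr_eq0// powRr1 ?(ltW e0).
Qed.

Lemma Lnorm2_cvg0P (u : nat -> T -> R) :
  Lnorm m 2%:E (EFin \o u n) @[n --> \oo] --> 0 <-> sqint (u n) @[n --> \oo] --> 0.
Proof.
split.
- move=> /(ge0_cvge0P (fun n => Lnorm_ge0 _ _ _)) H.
  apply/(ge0_cvge0P (fun n => sqint_ge0 _)) => e e0.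
  have se0 : (0 < Num.sqrt e)%R by rewrite sqrtr_gt0.
  have := H _ se0; apply: filterS => n /(Lnorm2_leP _ se0).
  by rewrite sqr_sqrtr// ltW.
- move=> /(ge0_cvge0P (fun n => sqint_ge0 _)) H.
  apply/(ge0_cvge0P (fun n => Lnorm_ge0 _ _ _)) => e e0.
  have e20 : (0 < e ^+ 2)%R by rewrite exprn_gt0.
  by have := H _ e20; apply: filterS => n h; apply/Lnorm2_leP.
Qed.

End square_integrals.

Section square_integral_limits.
Context d (T : measurableType d) (R : realType) (m : {measure set T -> \bar R}).
Implicit Types u f : T -> R.

Lemma sqint_le_lin (a b : T -> R) (k : R) :
  measurable_fun setT a -> measurable_fun setT b ->
  (sqint m (fun x => (a x + k * b x)%R) <=
   2%:E * sqint m a + (2 * k ^+ 2)%R%:E * sqint m b)%E.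
Proof.
move=> ma mb; rewrite /sqint.
have k0 : 0 <= 2 * k ^+ 2 by rewrite mulr_ge0// sqr_ge0.
have ma2 : measurable_fun setT (fun x => (a x ^+ 2)%:E).
  by apply/measurable_EFinP; exact: measurable_funX.
have mb2 : measurable_fun setT (fun x => (b x ^+ 2)%:E).
  by apply/measurable_EFinP; exact: measurable_funX.
rewrite -ge0_integralZl ?lee_fin//; last by move=> x _; rewrite lee_fin sqr_ge0.
rewrite -ge0_integralZl ?lee_fin//; last by move=> x _; rewrite lee_fin sqr_ge0.
rewrite -ge0_integralD//; first last.
- exact: measurable_funeM.
- by move=> x _; rewrite -EFinM lee_fin mulr_ge0// sqr_ge0.
- exact: measurable_funeM.
- by move=> x _; rewrite -EFinM lee_fin mulr_ge0// sqr_ge0.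
apply: ge0_le_integral => //.
- by move=> x _; rewrite lee_fin sqr_ge0.
- apply/measurable_EFinP; apply: measurable_funX; apply: measurable_funD => //.
  exact: measurable_funM.
- by apply: emeasurable_funD; exact: measurable_funeM.
- move=> x _; rewrite -!EFinM -EFinD lee_fin.
  by have := sqr_ge0 (a x - k * b x); nra.
Qed.

Lemma sqint_cvg0_lin (a b : nat -> T -> R) (k : R) :
  (forall n, measurable_fun setT (a n)) -> (forall n, measurable_fun setT (b n)) ->
  sqint m (a n) @[n --> \oo] --> 0%E -> sqint m (b n) @[n --> \oo] --> 0%E ->
  sqint m (fun x => a n x + k * b n x) @[n --> \oo] --> 0%E.
Proof.
move=> ma mb /(ge0_cvge0P (fun n => sqint_ge0 _ _)) Ha.
move=> /(ge0_cvge0P (fun n => sqint_ge0 _ _)) Hb.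
apply/(ge0_cvge0P (fun n => sqint_ge0 _ _)) => e e0.
have k1 : 0 < 4 * (k ^+ 2 + 1) by rewrite mulr_gt0// ltr_wpDl ?sqr_ge0.
have {}Ha := Ha (e / 4) (divr_gt0 e0 (ltr0Sn _ _)).
have {}Hb := Hb (e / (4 * (k ^+ 2 + 1))) (divr_gt0 e0 k1).
near=> n; apply: (le_trans (sqint_le_lin _ (ma n) (mb n))).
apply: (@le_trans _ _ (2%:E * (e / 4)%R%:E +
    (2 * k ^+ 2)%R%:E * (e / (4 * (k ^+ 2 + 1)))%R%:E)%E).
  apply: leeD; apply: lee_wpmul2l.
  - by rewrite lee_fin.
  - by near: n; exact: Ha.
  - by rewrite lee_fin mulr_ge0// sqr_ge0.
  - by near: n; exact: Hb.
rewrite -!EFinM -EFinD lee_fin.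
have -> : 2 * k ^+ 2 * (e / (4 * (k ^+ 2 + 1))) = (e / 2) * (k ^+ 2 / (k ^+ 2 + 1)).
  by field; rewrite gt_eqF// ltr_wpDl ?sqr_ge0.
have : k ^+ 2 / (k ^+ 2 + 1) <= 1.
  by rewrite ler_pdivrMr ?mul1r ?lerDl// ltr_wpDl ?sqr_ge0.
nra.
Unshelve. all: by end_near. Qed.

Lemma sqint_ae_eq (a b : T -> R) : measurable_fun setT a -> measurable_fun setT b ->
  {ae m, forall x, a x = b x} -> sqint m a = sqint m b.
Proof.
move=> ma mb ab; apply: ge0_ae_eq_integral => //.
- by apply/measurable_EFinP; exact: measurable_funX.
- by apply/measurable_EFinP; exact: measurable_funX.
- by move=> x _; rewrite lee_fin sqr_ge0.
- by move=> x _; rewrite lee_fin sqr_ge0.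
- by apply: ae_imply ab => x -> _.
Qed.

(** Dominated convergence, with bound 4 f^2. *)
Lemma truncation_sqint_cvg0 (phi : nat -> R -> R) f :
  (forall n, measurable_fun setT (phi n)) ->
  (forall n x, `|phi n x| <= `|x|) -> (forall x, phi n x @[n --> \oo] --> x) ->
  f \in Lfun m 2%:E ->
  sqint m (fun x => phi n (f x) - f x) @[n --> \oo] --> 0%E.
Proof.
move=> mphi phile phicvg /Lfun2P[mf foo].
pose F n x : \bar R := ((phi n (f x) - f x) ^+ 2)%:E.
have mF n : measurable_fun setT (F n).
  apply/measurable_EFinP; apply: measurable_funX; apply: measurable_funB => //.
  exact: measurableT_comp.
have ig : m.-integrable setT (fun x => (4 * f x ^+ 2)%:E).
  apply/integrableP; split.
    by apply/measurable_EFinP; apply: measurable_funM => //; exact: measurable_funX.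
  rewrite (eq_integral (fun x => (4%:E * (f x ^+ 2)%:E)%E)); last first.
    by move=> x _; rewrite gee0_abs ?EFinM// lee_fin mulr_ge0// sqr_ge0.
  rewrite ge0_integralZl//; last 2 first.
  - by apply/measurable_EFinP; exact: measurable_funX.
  - by move=> x _; rewrite lee_fin sqr_ge0.
  exact: lte_mul_pinfty.
have mc : measurable_fun [set: T] (cst 0%E : T -> \bar R) by exact: measurable_cst.
have H1 : {ae m, forall x, setT x -> F n x @[n --> \oo] --> cst 0%E x}.
  apply: aeW => x _; apply: cvg_EFin; first exact: nearW.
  have z0 : (f x - f x) * (f x - f x) = 0 by rewrite subrr mulr0.
  rewrite -[X in _ --> X]z0.
  have h : phi n (f x) - f x @[n --> \oo] --> f x - f x.
    by apply: (@cvgB _ R^o); [exact: phicvg|exact: cvg_cst].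
  by under eq_cvg do rewrite /= expr2; exact: cvgM.
have H2 : {ae m, forall x n, setT x -> (`|F n x| <= (4 * f x ^+ 2)%:E)%E}.
  apply: aeW => x n _; rewrite /F gee0_abs ?lee_fin ?sqr_ge0//.
  rewrite -[leLHS]ger0_norm ?sqr_ge0// normrX.
  have : `|phi n (f x) - f x| <= 2 * `|f x|.
    by apply: (le_trans (ler_normB _ _)); have := phile n (f x); lra.
  move=> h; apply: (@le_trans _ _ ((2 * `|f x|) ^+ 2)).
    by rewrite ler_pXn2r// ?nnegrE// mulr_ge0.
  by rewrite exprMn real_normK ?num_real// -natrX.
have [_ _] := dominated_convergence measurableT mF mc H1 ig H2.
by rewrite integral0.
Qed.

Lemma measurable_norm_ge u (e : R) : measurable_fun setT u ->
  measurable [set x | e <= `|u x|].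
Proof.
move=> mu; have := measurable_fun_ler (measurable_cst e)
  (measurableT_comp (@normr_measurable R setT) mu).
by move=> /(_ measurableT [set true] I); rewrite setTI.
Qed.

(** Markov's inequality for the square of u. *)
Lemma sqint_markov u (e : R) : measurable_fun setT u -> 0 < e ->
  ((e ^+ 2)%:E * m [set x | (e <= `|u x|)%R] <= sqint m u)%E.
Proof.
move=> mu e0.
have mS := measurable_norm_ge e mu.
rewrite -integral_cst//; apply: (@le_trans _ _
  (\int[m]_(x in [set x | (e <= `|u x|)%R]) (u x ^+ 2)%:E)%E).
  apply: ge0_le_integral => //.
  - by move=> x _; rewrite lee_fin sqr_ge0.
  - by apply/measurable_EFinP; apply: measurable_funTS; exact: measurable_funX.
  - move=> x /= ex; rewrite lee_fin -[leRHS]real_normK ?num_real//.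
    by rewrite ler_pXn2r// nnegrE ltW.
apply: ge0_subset_integral => //.
- by apply/measurable_EFinP; exact: measurable_funX.
- by move=> x _; rewrite lee_fin sqr_ge0.
Qed.

End square_integral_limits.

(** * Compensated integrals as limits *)

Lemma eq_sqint_cvg d (T : measurableType d) (R : realType)
    (m : {measure set T -> \bar R}) (u v : nat -> T -> R) (l : \bar R) :
  (forall n x, u n x = v n x) ->
  sqint m (u n) @[n --> \oo] --> l -> sqint m (v n) @[n --> \oo] --> l.
Proof. by move=> uv; have -> : u = v by apply/funext => n; apply/funext. Qed.

Section compensated_limits.
Context d (T : measurableType d) (R : realType) (P : probability T R).
Context d' (E : measurableType d') (N : T -> {measure set E -> \bar R})
  (mu : {measure set E -> \bar R}).
Hypothesis prmN : poisson_random_measure P N mu.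

(** Integrands whose compensated integral is almost surely the difference of two
    convergent Lebesgue integrals, hence linear in the integrand. *)
Definition tame (g : E -> R) :=
  [/\ measurable_fun setT g, mu.-integrable setT (EFin \o g), (sqint mu g < +oo)%E &
      {ae P, forall w, (N w).-integrable setT (EFin \o g)}].

Definition compensated (g : E -> R) (w : T) : R :=
  \int[N w]_p g p - \int[mu]_p g p.

Lemma measurable_compensated g : measurable_fun setT g ->
  measurable_fun setT (compensated g).
Proof.
move=> mg; apply: measurable_funB => //; apply: measurable_Rintegral => //.
exact: prm_measurable prmN.
Qed.

Lemma tame_lin (g h : E -> R) (k : R) : tame g -> tame h ->
  tame (fun p => g p + k * h p).
Proof.
move=> [mg ig sg ag] [mh ih sh ah].
have int (m : {measure set E -> \bar R}) : m.-integrable setT (EFin \o g) ->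
    m.-integrable setT (EFin \o h) ->
    m.-integrable setT (EFin \o (fun p => g p + k * h p)).
  move=> mig mih; have := integrableD measurableT mig (integrableZl measurableT k mih).
  by congr (integrable _ _ _); apply/funext => p /=; rewrite EFinD EFinM.
split.
- by apply: measurable_funD => //; exact: measurable_funM.
- exact: int.
- apply: (le_lt_trans (sqint_le_lin _ _ mg mh)).
  have k2 : (0 <= (2 * k ^+ 2)%R%:E)%E by rewrite lee_fin mulr_ge0// sqr_ge0.
  by rewrite lte_add_pinfty// lte_mul_pinfty.
- by move: ag ah; apply: ae_imply2 => w; exact: int.
Qed.

Lemma compensated_lin (g h : E -> R) (k : R) : tame g -> tame h ->
  {ae P, forall w, compensated (fun p => g p + k * h p) w =
                   compensated g w + k * compensated h w}.
Proof.
move=> [mg ig sg ag] [mh ih sh ah].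
have int (m : {measure set E -> \bar R}) : m.-integrable setT (EFin \o g) ->
    m.-integrable setT (EFin \o h) ->
    \int[m]_p (g p + k * h p) = \int[m]_p g p + k * \int[m]_p h p.
  move=> mig mih; rewrite RintegralD//; last first.
    have := integrableZl measurableT k mih.
    by congr (integrable _ _ _); apply/funext => p /=; rewrite EFinM.
  by rewrite RintegralZl.
move: ag ah; apply: ae_imply2 => w gw hw.
by rewrite /compensated !int//; ring.
Qed.

(** Each of the finitely many nonzero fibres has finite intensity, hence almost
    surely finite mass under N. *)
Lemma finite_range_tame (g : E -> R * R) :
  measurable_fun setT g -> finite_set (range g) ->
  (forall v : R * R, v != 0%R -> (mu (g @^-1` [set v]) < +oo)%E) ->
  (sqint mu (fun p => (g p).1) < +oo)%E -> (sqint mu (fun p => (g p).2) < +oo)%E ->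
  tame (fun p => (g p).1) /\ tame (fun p => (g p).2).
Proof.
move=> mg fg goo s1 s2.
have [n [v [injv v0 gE]]] := finite_range_step mg fg.
have mB i : measurable (g @^-1` [set v i]).
  by rewrite -[X in measurable X]setTI; apply: mg => //; exact: measurable_set1_pair.
have ae : {ae P, forall w, forall i, (N w (g @^-1` [set v i]) < +oo)%E}.
  apply: ae_forall_ord => i.
  apply: ae_imply (prm_count_nat prmN (mB i) (goo _ (v0 i))) => w [k ->].
  exact: ltry.
have key (f : E -> R) (c : 'I_n -> R) : measurable_fun setT f ->
    (forall p, f p = step c (fun i => g @^-1` [set v i]) p) ->
    (sqint mu f < +oo)%E -> tame f.
  move=> mf fE sf; split => //.
  - have -> : f = step c (fun i => g @^-1` [set v i]) by exact/funext.
    by apply: step_integrable => // i; exact: goo.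
  - apply: ae_imply ae => w Nw.
    have -> : f = step c (fun i => g @^-1` [set v i]) by exact/funext.
    exact: step_integrable.
split.
- apply: (key _ (fun i => (v i).1)) => //; first exact: measurableT_comp.
  by move=> p; rewrite gE.
- apply: (key _ (fun i => (v i).2)) => //; first exact: measurableT_comp.
  by move=> p; rewrite gE.
Qed.

Lemma compensated_cvg f I (g : nat -> E -> R) :
  compensated_integral P N mu f I -> (forall n, tame (g n)) ->
  sqint mu (fun p => g n p - f p) @[n --> \oo] --> 0%E ->
  sqint P (fun w => compensated (g n) w - I w) @[n --> \oo] --> 0%E.
Proof.
move=> [mI fL H] tg gf.
apply/(Lnorm2_cvg0P _ (fun n w => compensated (g n) w - I w)); apply: H.
- move=> n; have [mg ig sg _] := tg n; split; last by apply/Lfun2P.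
  exact/Lfun1_integrable.
- exact/(Lnorm2_cvg0P _ (fun n p => g n p - f p)).
Qed.

(** The hypotheses speak of approximations of f1 and of f2 only, not of their
    combination. The error e n = h n - a g1 n - b g2 n tends to 0, so
    k n = g1 n + e n approximates f1 as well as g1 n does; comparing the two, the
    compensated integrals of e n tend to 0. *)
Lemma compensated_cvg_lin f1 f2 I1 I2 (a b : R) (g1 g2 h : nat -> E -> R) :
  compensated_integral P N mu f1 I1 -> compensated_integral P N mu f2 I2 ->
  (forall n, tame (g1 n)) -> (forall n, tame (g2 n)) -> (forall n, tame (h n)) ->
  sqint mu (fun p => g1 n p - f1 p) @[n --> \oo] --> 0%E ->
  sqint mu (fun p => g2 n p - f2 p) @[n --> \oo] --> 0%E ->
  sqint mu (fun p => h n p - (a * f1 p + b * f2 p)) @[n --> \oo] --> 0%E ->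
  sqint P (fun w => compensated (h n) w - (a * I1 w + b * I2 w)) @[n --> \oo] --> 0%E.
Proof.
move=> cI1 cI2 t1 t2 th c1 c2 ch.
have [mI1 /Lfun2P[mf1 _] _] := cI1; have [mI2 /Lfun2P[mf2 _] _] := cI2.
have m1 n : measurable_fun setT (g1 n) by have [] := t1 n.
have m2 n : measurable_fun setT (g2 n) by have [] := t2 n.
have mh n : measurable_fun setT (h n) by have [] := th n.
pose e n p := (h n p + - a * g1 n p) + - b * g2 n p.
have te n : tame (e n) by do 2 apply: tame_lin => //.
have me n : measurable_fun setT (e n) by have [] := te n.
pose k n p := g1 n p + 1 * e n p.
have tk n : tame (k n) by exact: tame_lin.
have mhf n : measurable_fun setT (fun p => h n p - (a * f1 p + b * f2 p)).
  apply: measurable_funB => //; apply: measurable_funD; exact: measurable_funM.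
have mgf1 n : measurable_fun setT (fun p => g1 n p - f1 p) by exact: measurable_funB.
have mgf2 n : measurable_fun setT (fun p => g2 n p - f2 p) by exact: measurable_funB.
have ce : sqint mu (e n) @[n --> \oo] --> 0%E.
  have mhf1 n : measurable_fun setT
      (fun p => h n p - (a * f1 p + b * f2 p) + - a * (g1 n p - f1 p)).
    by apply: measurable_funD => //; exact: measurable_funM.
  have := sqint_cvg0_lin (- b) mhf1 mgf2 (sqint_cvg0_lin (- a) mhf mgf1 ch c1) c2.
  by apply: eq_sqint_cvg => n p; rewrite /e; ring.
have ck : sqint mu (fun p => k n p - f1 p) @[n --> \oo] --> 0%E.
  have := sqint_cvg0_lin 1 mgf1 me c1 ce.
  by apply: eq_sqint_cvg => n p; rewrite /k; ring.
have C1 := compensated_cvg cI1 t1 c1.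
have C2 := compensated_cvg cI2 t2 c2.
have Ck := compensated_cvg cI1 tk ck.
have mC (g : E -> R) (I : T -> R) : measurable_fun setT g -> measurable_fun setT I ->
    measurable_fun setT (fun w => compensated g w - I w).
  by move=> mg mI; apply: measurable_funB => //; exact: measurable_compensated.
have mk n : measurable_fun setT (k n) by have [] := tk n.
have mD1 n := mC _ _ (m1 n) mI1.
have mD2 n := mC _ _ (m2 n) mI2.
have mDk n := mC _ _ (mk n) mI1.
have L1 := sqint_cvg0_lin (a - 1) mDk mD1 Ck C1.
have mL1 n : measurable_fun setT (fun w =>
    compensated (k n) w - I1 w + (a - 1) * (compensated (g1 n) w - I1 w)).
  by apply: measurable_funD => //; exact: measurable_funM.
have := sqint_cvg0_lin b mL1 mD2 L1 C2.
rewrite (_ : (fun n => sqint P (fun x => _)) =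
  fun n => sqint P (fun w => compensated (h n) w - (a * I1 w + b * I2 w)))//.
apply/funext => n; apply: sqint_ae_eq.
- by apply: measurable_funD => //; exact: measurable_funM.
- apply: mC => //; apply: measurable_funD; exact: measurable_funM.
have A1 := compensated_lin 1 (t1 n) (te n).
have A2 := compensated_lin (- b) (tame_lin (- a) (th n) (t1 n)) (t2 n).
have A3 := compensated_lin (- a) (th n) (t1 n).
apply: (ae_imply2 _ A1 (ae_imply2 (fun w x y => conj x y) A2 A3)) => w kE [eE e'E].
by rewrite /k kE /e eE e'E; ring.
Qed.

End compensated_limits.

(** * Laws of limits *)

Section uniqueness.
Context (R : realType).

Lemma finite_measure_ray_unique (m1 m2 : {measure set R -> \bar R}) :
  (m1 setT < +oo)%E ->
  (forall x, m1 `]-oo, x[%classic = m2 `]-oo, x[%classic) ->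
  forall A, measurable A -> m1 A = m2 A.
Proof.
move=> m1oo m12 A mA.
apply: (measure_unique (@RGenInftyO.G R) (fun n => `]-oo, n%:R[%classic)) => //.
- exact: RGenInftyO.measurableE.
- move=> _ _ [x ->] [y ->]; exists (Num.min x y).
  by apply/seteqP; split => z /=; rewrite !in_itv/= lt_min => /andP.
- by move=> n; exists n%:R.
- apply/seteqP; split => // x _; exists (Num.truncn `|x|).+1 => //=.
  by rewrite in_itv/= (le_lt_trans (ler_norm x))// truncnS_gt.
- by move=> _ [x ->].
- move=> n; apply: le_lt_trans m1oo; apply: le_measure; rewrite ?inE//.
Qed.

Lemma finite_measure_rectangle_unique (m1 m2 : {measure set (R * R) -> \bar R}) :
  (m1 setT < +oo)%E ->
  (forall A B, measurable A -> measurable B -> m1 (A `*` B) = m2 (A `*` B)) ->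
  forall C, measurable C -> m1 C = m2 C.
Proof.
move=> m1oo m12 C mC.
apply: (measure_unique [set A `*` B | A in measurable & B in measurable]
  (fun=> setT)) => //.
- by rewrite measurable_prod_measurableType.
- move=> _ _ [A1 mA1 [B1 mB1 <-]] [A2 mA2 [B2 mB2 <-]]; rewrite -setXI.
  exists (A1 `&` A2); first exact: measurableI.
  by exists (B1 `&` B2) => //; exact: measurableI.
- by move=> n; exists setT => //; exists setT => //; rewrite setXTT.
- by rewrite bigcup_const//; exists 0%N.
- by move=> _ [A mA [B mB <-]]; exact: m12.
Qed.

(** Quadrants determine first the measures of products of a ray and a Borel set,
    then those of products of Borel sets. *)
Lemma finite_measure_quadrant_unique (m1 m2 : {measure set (R * R) -> \bar R}) :
  (m1 setT < +oo)%E ->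
  (forall x y, m1 (`]-oo, x[%classic `*` `]-oo, y[%classic) =
               m2 (`]-oo, x[%classic `*` `]-oo, y[%classic)) ->
  forall C, measurable C -> m1 C = m2 C.
Proof.
move=> m1oo m12; apply: finite_measure_rectangle_unique => // A B mA mB.
have mX (C D : set R) : measurable C -> measurable D -> measurable (C `*` D).
  by move=> mC mD; exact: measurableX.
have oo (C : set (R * R)) : measurable C -> (m1 C < +oo)%E.
  by move=> mC; apply: le_lt_trans m1oo; apply: le_measure; rewrite ?inE.
have step1 x : m1 (`]-oo, x[%classic `*` B) = m2 (`]-oo, x[%classic `*` B).
  have mD : measurable (`]-oo, x[%classic `*` setT : set (R * R)) by exact: mX.
  pose M' (m : {measure set (R * R) -> \bar R}) : {measure set R -> \bar R} :=
    pushforward (mrestr m mD) (@snd R R).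
  pose M := M' measurable_snd.
  have ME m D : M m D = m (`]-oo, x[%classic `*` D).
    rewrite /M /M' /= /pushforward /mrestr; congr (m _).
    by apply/seteqP; split => -[u v] /= [] //= ? [].
  rewrite -(ME m1) -(ME m2); apply: finite_measure_ray_unique => //.
    by rewrite ME; apply: oo; exact: mX.
  by move=> y; rewrite !ME.
have mD : measurable (setT `*` B : set (R * R)) by exact: mX.
pose M' (m : {measure set (R * R) -> \bar R}) : {measure set R -> \bar R} :=
  pushforward (mrestr m mD) (@fst R R).
pose M := M' measurable_fst.
have ME m D : M m D = m (D `*` B).
  rewrite /M /M' /= /pushforward /mrestr; congr (m _).
  by apply/seteqP; split => -[u v] /= [] //= ? [].
rewrite -(ME m1) -(ME m2); apply: finite_measure_ray_unique => //.
  by rewrite ME; apply: oo; exact: mX.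
by move=> y; rewrite !ME.
Qed.

Lemma law_exists d (T : measurableType d) d' (T' : measurableType d')
    (P : probability T R) (X : T -> T') : measurable_fun setT X ->
  exists m : probability T' R, forall A, measurable A -> m A = P (X @^-1` A).
Proof.
move=> mX; pose X' : {mfun T >-> T'} := mfun_Sub (mem_set mX).
by exists (distribution P X').
Qed.

End uniqueness.

Section law_of_limits.
Context d (T : measurableType d) (R : realType) (P : probability T R).

Lemma sqint_cvg0_probability (u : nat -> T -> R) (e dl : R) :
  (forall n, measurable_fun setT (u n)) -> 0 < e -> 0 < dl ->
  sqint P (u n) @[n --> \oo] --> 0%E ->
  \forall n \near \oo, (P [set w | (e <= `|u n w|)%R] <= dl%:E)%E.
Proof.
move=> mu e0 dl0 /(ge0_cvge0P (fun n => sqint_ge0 _ _)) H.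
have e20 : 0 < e ^+ 2 by rewrite exprn_gt0.
have He := H _ (mulr_gt0 e20 dl0); near=> n.
rewrite -(@lee_pmul2l _ (e ^+ 2)%:E)// ?lte_fin//.
apply: le_trans (sqint_markov _ (mu n) e0) _; rewrite -EFinM.
by near: n; exact: He.
Unshelve. all: by end_near. Qed.

Let quadrant (u : T -> R * R) (x y : R) : set T :=
  [set w | (u w).1 < x /\ (u w).2 < y].

Let measurable_quadrant u x y : measurable_fun setT u -> measurable (quadrant u x y).
Proof.
move=> mu; have := mu measurableT (`]-oo, x[%classic `*` `]-oo, y[%classic)
  (measurableX (measurable_itv _) (measurable_itv _)).
rewrite setTI; congr measurable.
Qed.

Variables (X Y : nat -> T -> R * R) (I J : T -> R * R).
Hypotheses (mX : forall n, measurable_fun setT (X n))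
  (mY : forall n, measurable_fun setT (Y n)).
Hypotheses (mI : measurable_fun setT I) (mJ : measurable_fun setT J).
Hypothesis XY : forall n A, measurable A -> P (X n @^-1` A) = P (Y n @^-1` A).
Hypotheses
  (XI1 : sqint P (fun w => (X n w).1 - (I w).1) @[n --> \oo] --> 0%E)
  (XI2 : sqint P (fun w => (X n w).2 - (I w).2) @[n --> \oo] --> 0%E)
  (YJ1 : sqint P (fun w => (Y n w).1 - (J w).1) @[n --> \oo] --> 0%E)
  (YJ2 : sqint P (fun w => (Y n w).2 - (J w).2) @[n --> \oo] --> 0%E).

(** I is close to X n, which has the law of Y n, which is close to J. Each of the
    two approximations costs a shift of the quadrant by e, and e tends to 0. *)
Lemma quadrant_le (x y : R) : (P (quadrant I x y) <= P (quadrant J x y))%E.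
Proof.
have m1 (u : T -> R * R) : measurable_fun setT u ->
    measurable_fun setT (fun w => (u w).1).
  by move=> mu; exact: measurableT_comp.
have m2 (u : T -> R * R) : measurable_fun setT u ->
    measurable_fun setT (fun w => (u w).2).
  by move=> mu; exact: measurableT_comp.
pose bad1 (u v : T -> R * R) (e : R) := [set w | e <= `|(v w).1 - (u w).1|].
pose bad2 (u v : T -> R * R) (e : R) := [set w | e <= `|(v w).2 - (u w).2|].
have quad_le (u v : T -> R * R) (e : R) (a b : R) : 0 < e ->
    measurable_fun setT u -> measurable_fun setT v ->
    (P (quadrant u (a - e) (b - e)) <= P (quadrant v a b) +
      (P (bad1 (u) (v) e) + P (bad2 (u) (v) e)))%E.
  move=> e0 mu mv.
  have mb1 : measurable (bad1 (u) (v) e).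
    by apply: measurable_norm_ge; apply: measurable_funB; exact: m1.
  have mb2 : measurable (bad2 (u) (v) e).
    by apply: measurable_norm_ge; apply: measurable_funB; exact: m2.
  apply: (@le_trans _ _ (P (quadrant v a b `|` (bad1 (u) (v) e `|`
       bad2 (u) (v) e)))).
    apply: le_measure; rewrite ?inE.
    - exact: measurable_quadrant.
    - by apply: measurableU; [exact: measurable_quadrant|exact: measurableU].
    - move=> w [/= u1 u2].
      have [h1|h1] := leP e `|(v w).1 - (u w).1|; first by right; left.
      have [h2|h2] := leP e `|(v w).2 - (u w).2|; first by right; right.
      by left; move: h1 h2; rewrite !ltr_norml => /andP[_ ?] /andP[_ ?]; split; lra.
  apply: (le_trans (measureU2 _ _ _)); [exact: measurable_quadrant|exact: measurableU|].
  by apply: leeD2l; exact: measureU2.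
have shrink (e : R) : 0 < e ->
    (P (quadrant I (x - (e + e)) (y - (e + e))) <= P (quadrant J x y))%E.
  move=> e0; apply/lee_addgt0Pr => dl dl0.
  have dl4 : 0 < dl / 4 by rewrite divr_gt0.
  have mB1 n : measurable_fun setT (fun w => (X n w).1 - (I w).1).
    by apply: measurable_funB; exact: m1.
  have mB2 n : measurable_fun setT (fun w => (X n w).2 - (I w).2).
    by apply: measurable_funB; exact: m2.
  have mC1 n : measurable_fun setT (fun w => (Y n w).1 - (J w).1).
    by apply: measurable_funB; exact: m1.
  have mC2 n : measurable_fun setT (fun w => (Y n w).2 - (J w).2).
    by apply: measurable_funB; exact: m2.
  have H1 := sqint_cvg0_probability mB1 e0 dl4 XI1.
  have H2 := sqint_cvg0_probability mB2 e0 dl4 XI2.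
  have H3 := sqint_cvg0_probability mC1 e0 dl4 YJ1.
  have H4 := sqint_cvg0_probability mC2 e0 dl4 YJ2.
  near \oo => n.
  have h1 : (P (bad1 (I) (X n) e) <= (dl / 4)%:E)%E by near: n; exact: H1.
  have h2 : (P (bad2 (I) (X n) e) <= (dl / 4)%:E)%E by near: n; exact: H2.
  have h3 : (P (bad1 (Y n) (J) e) <= (dl / 4)%:E)%E.
    rewrite (_ : bad1 _ _ _ = bad1 (J) (Y n) e); first by near: n; exact: H3.
    by apply/funext => w; rewrite /bad1/bad2/= distrC.
  have h4 : (P (bad2 (Y n) (J) e) <= (dl / 4)%:E)%E.
    rewrite (_ : bad2 _ _ _ = bad2 (J) (Y n) e); first by near: n; exact: H4.
    by apply/funext => w; rewrite /bad1/bad2/= distrC.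
  have XYq : P (quadrant (X n) (x - e) (y - e)) = P (quadrant (Y n) (x - e) (y - e)).
    have := XY n (measurableX (measurable_itv `]-oo, x - e[)
      (measurable_itv `]-oo, y - e[)).
    congr (_ = _); congr (P _); by apply/seteqP; split => w /=; rewrite !in_itv.
  rewrite !opprD !addrA.
  apply: (le_trans (quad_le _ _ _ _ _ e0 mI (mX n))); rewrite XYq.
  apply: (@le_trans _ _ ((P (quadrant J x y) + ((dl / 4)%R%:E + (dl / 4)%R%:E)) +
    ((dl / 4)%R%:E + (dl / 4)%R%:E))%E).
    apply: leeD; last exact: leeD.
    apply: (le_trans (quad_le _ _ _ _ _ e0 (mY n) mJ)).
    by apply: leeD2l; exact: leeD.
  rewrite -!EFinD -addeA -EFinD; apply: leeD2l; rewrite lee_fin; lra.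
pose F k := quadrant I (x - (k.+1%:R^-1 + k.+1%:R^-1))
                       (y - (k.+1%:R^-1 + k.+1%:R^-1)).
have mF k : measurable (F k) by exact: measurable_quadrant.
have FU : \bigcup_k F k = quadrant I x y.
  apply/seteqP; split => w.
    move=> [k _ [/= h1 h2]].
    have : 0 < k.+1%:R^-1 :> R by rewrite invr_gt0.
    by move: (k.+1%:R^-1) h1 h2 => q h1 h2 q0; split; lra.
  move=> [/= h1 h2].
  pose g := Num.min (x - (I w).1) (y - (I w).2) / 2.
  have g0 : 0 < g by rewrite divr_gt0// lt_min !subr_gt0 h1 h2.
  have gx : 2 * g <= x - (I w).1 by rewrite /g mulrC divfK// ge_min lexx.
  have gy : 2 * g <= y - (I w).2 by rewrite /g mulrC divfK// ge_min lexx orbT.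
  have [k kg] : exists k : nat, k.+1%:R^-1 < g.
    near \oo => k; exists k; near: k; exact: near_infty_natSinv_lt (PosNum g0).
  by exists k => //; split => /=; move: g (k.+1%:R^-1) gx gy kg {g0} => g q; lra.
have ndF : nondecreasing_seq F.
  move=> i j ij; apply/subsetPset => w [/= h1 h2].
  have : j.+1%:R^-1 <= i.+1%:R^-1 :> R by rewrite lef_pV2 ?posrE// ler_nat.
  by move=> ji; split => /=; move: (j.+1%:R^-1) (i.+1%:R^-1) h1 h2 ji => p q; lra.
have := nondecreasing_cvg_mu (mu := P) mF (bigcup_measurable (fun k _ => mF k)) ndF.
rewrite FU => Fcvg; rewrite -(cvg_lim _ Fcvg)//.
apply: lime_le; first by apply: cvgP Fcvg.
apply: nearW => k /=; apply: shrink; by rewrite invr_gt0.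
Unshelve. all: by end_near. Qed.

End law_of_limits.

Section limit_law_eq.
Context d (T : measurableType d) (R : realType) (P : probability T R).
Variables (X Y : nat -> T -> R * R) (I J : T -> R * R).
Hypotheses (mX : forall n, measurable_fun setT (X n))
  (mY : forall n, measurable_fun setT (Y n)).
Hypotheses (mI : measurable_fun setT I) (mJ : measurable_fun setT J).
Hypothesis XY : forall n A, measurable A -> P (X n @^-1` A) = P (Y n @^-1` A).
Hypotheses
  (XI1 : sqint P (fun w => (X n w).1 - (I w).1) @[n --> \oo] --> 0%E)
  (XI2 : sqint P (fun w => (X n w).2 - (I w).2) @[n --> \oo] --> 0%E)
  (YJ1 : sqint P (fun w => (Y n w).1 - (J w).1) @[n --> \oo] --> 0%E)
  (YJ2 : sqint P (fun w => (Y n w).2 - (J w).2) @[n --> \oo] --> 0%E).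

Lemma limit_law_eq A : measurable A -> P (I @^-1` A) = P (J @^-1` A).
Proof.
move=> mA; have [m1 m1E] := law_exists P mI; have [m2 m2E] := law_exists P mJ.
rewrite -m1E// -m2E//; apply: finite_measure_quadrant_unique => //.
  by apply: (@le_lt_trans _ _ 1%E); [rewrite -(@probability_setT _ _ _ m1)|exact: ltry].
move=> x y.
have mQ : measurable (`]-oo, x[%classic `*` `]-oo, y[%classic : set (R * R)).
  exact: measurableX.
rewrite [LHS](m1E _ mQ) [RHS](m2E _ mQ).
have pre (u : T -> R * R) : u @^-1` (`]-oo, x[%classic `*` `]-oo, y[%classic) =
    [set w | (u w).1 < x /\ (u w).2 < y].
  by apply/seteqP; split => w /=; rewrite !in_itv.
rewrite !pre; apply/eqP; rewrite eq_le; apply/andP; split.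
  exact: (quadrant_le mX mY mI mJ XY XI1 XI2 YJ1 YJ2).
by apply: (quadrant_le mY mX mJ mI _ YJ1 YJ2 XI1 XI2) => n B mB; rewrite XY.
Qed.

End limit_law_eq.

(** * Rotating a compensated integral *)

Section truncated_pairs.
Context (R : realType) d' (E : measurableType d') (mu : {measure set E -> \bar R}).
Variables (phi : R -> R) (f1 f2 : E -> R).
Hypotheses (mphi : measurable_fun setT phi) (fphi : finite_set (range phi))
  (phile : forall x, `|phi x| <= `|x|).
Hypotheses (L1 : f1 \in Lfun mu 2%:E) (L2 : f2 \in Lfun mu 2%:E).

(** Both coordinates are truncated by the same function of one variable, so that
    truncating f o th is the same as truncating f and composing with th. *)
Definition truncated_pair (p : E) : R * R := (phi (f1 p), phi (f2 p)).

Lemma measurable_truncated_pair : measurable_fun setT truncated_pair.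
Proof.
have [mf1 _] := (Lfun2P _ _).1 L1; have [mf2 _] := (Lfun2P _ _).1 L2.
by apply: measurable_fun_pair; exact: measurableT_comp.
Qed.

Lemma finite_range_truncated_pair : finite_set (range truncated_pair).
Proof.
apply: (@sub_finite_set _ _ [set (x, y) | x in range phi & y in range phi]).
  by move=> _ [p _ <-]; exists (phi (f1 p)); [by exists (f1 p)|
    exists (phi (f2 p)) => //; by exists (f2 p)].
exact: finite_image2.
Qed.

Let fiber_lty (f : E -> R) (v : R) : f \in Lfun mu 2%:E -> v != 0 ->
  exists S, [/\ measurable S, (mu S < +oo)%E & [set p | phi (f p) = v] `<=` S].
Proof.
move=> /Lfun2P[mf sf] v0; exists [set p | `|v| <= `|f p|]; split.
- exact: measurable_norm_ge.
- have nv : 0 < `|v| by rewrite normr_gt0.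
  have v2 : (0 < (`|v| ^+ 2)%:E)%E by rewrite lte_fin exprn_gt0.
  have h := le_lt_trans (sqint_markov mu mf nv) sf.
  rewrite ltey; apply: contraTN h => /eqP ->.
  by rewrite gt0_muley// ltxx.
- by move=> p /= <-; exact: phile.
Qed.

(** On a nonzero fibre one of f1, f2 is bounded away from 0, and Markov's
    inequality applies. *)
Lemma truncated_pair_fiber_lty (v : R * R) : v != 0%R ->
  (mu (truncated_pair @^-1` [set v]) < +oo)%E.
Proof.
move=> v0.
have mv : measurable (truncated_pair @^-1` [set v]).
  rewrite -[X in measurable X]setTI; apply: measurable_truncated_pair => //.
  exact: measurable_set1_pair.
suff [S [mS Soo vS]] : exists S, [/\ measurable S, (mu S < +oo)%E &
    truncated_pair @^-1` [set v] `<=` S].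
  by apply: le_lt_trans Soo; apply: le_measure; rewrite ?inE.
have [v10|v10] := eqVneq v.1 0.
  have v20 : v.2 != 0.
    by apply: contra_neq v0 => v20; rewrite (surjective_pairing v) v10 v20.
  have [S [mS Soo vS]] := fiber_lty L2 v20; exists S; split => // p /= pv.
  by apply: vS; rewrite /= -pv.
have [S [mS Soo vS]] := fiber_lty L1 v10; exists S; split => // p /= pv.
by apply: vS; rewrite /= -pv.
Qed.

Lemma sqint_truncation_lty f : f \in Lfun mu 2%:E ->
  (sqint mu (fun p => phi (f p)) < +oo)%E.
Proof.
move=> /Lfun2P[mf sf]; apply: le_lt_trans sf; apply: ge0_le_integral => //.
- by move=> x _; rewrite lee_fin sqr_ge0.
- by apply/measurable_EFinP; apply: measurable_funX; exact: measurableT_comp.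
- by apply/measurable_EFinP; exact: measurable_funX.
- move=> x _; rewrite lee_fin -[leLHS]real_normK ?num_real//.
  rewrite -[leRHS]real_normK ?num_real//.
  by rewrite ler_pXn2r// nnegrE.
Qed.

End truncated_pairs.

Section rotation_of_compensated_integrals.
Context d (T : measurableType d) (R : realType) (P : probability T R).
Context d' (E : measurableType d') (N : T -> {measure set E -> \bar R})
  (mu : {measure set E -> \bar R}).
Hypothesis prmN : poisson_random_measure P N mu.
Variables (f1 f2 : E -> R) (I1 I2 : T -> R) (th : E -> E) (a : R).
Hypotheses (mth : measurable_fun setT th)
  (muth : forall B, measurable B -> mu (th @^-1` B) = mu B).
Hypotheses (cI1 : compensated_integral P N mu f1 I1)
  (cI2 : compensated_integral P N mu f2 I2).
Hypothesis rotf : forall p, (f1 (th p), f2 (th p)) = rot a (f1 p, f2 p).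

Lemma Rintegral_preserved (g : E -> R * R) (pr : R * R -> R) :
  pr = fst \/ pr = snd ->
  measurable_fun setT g -> finite_set (range g) ->
  (forall v : R * R, v != 0%R -> (mu (g @^-1` [set v]) < +oo)%E) ->
  \int[mu]_p pr (g (th p)) = \int[mu]_p pr (g p).
Proof.
move=> prE mg fg goo.
have [n [v [injv v0 gE]]] := finite_range_step mg fg.
have mB i : measurable (g @^-1` [set v i]).
  by rewrite -[X in measurable X]setTI; apply: mg => //; exact: measurable_set1_pair.
have mB' i : measurable (th @^-1` (g @^-1` [set v i])).
  by rewrite -[X in measurable X]setTI; exact: mth.
have muB i : mu (g @^-1` [set v i]) = (fine (mu (g @^-1` [set v i])))%:E.
  by rewrite fineK// ge0_fin_numE// goo.
have prg p : pr (g p) = step (fun i => pr (v i)) (fun i => g @^-1` [set v i]) p.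
  by case: prE => ->; rewrite gE.
transitivity (\int[mu]_p step (fun i => pr (v i))
  (fun i => th @^-1` (g @^-1` [set v i])) p).
  by apply: eq_Rintegral => p _; rewrite prg.
transitivity (\int[mu]_p step (fun i => pr (v i))
  (fun i => g @^-1` [set v i]) p); last first.
  by apply: eq_Rintegral => p _; rewrite prg.
rewrite (Rintegral_step _ mB muB).
rewrite (Rintegral_step _ mB' (x := fun i => fine (mu (g @^-1` [set v i]))))//.
by move=> i; rewrite muth.
Qed.

(** The compensated integrals of the truncations of (f1, f2) and of
    (f1, f2) o th have the same law, since th preserves mu. The former tend to
    (I1, I2) and the latter, by linearity, to its image under rot a. *)
Lemma compensated_pair_rotation (A : set (R * R)) : measurable A ->
  P [set w | A (rot a (I1 w, I2 w))] = P [set w | A (I1 w, I2 w)].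
Proof.
move=> mA; have [phi [mphi fphi phile phicvg]] := truncation_exists R.
have [mI1 L1 _] := cI1; have [mI2 L2 _] := cI2.
have [mf1 s1] := (Lfun2P _ _).1 L1; have [mf2 s2] := (Lfun2P _ _).1 L2.
have rot1 p : f1 (th p) = cos a * f1 p + - sin a * f2 p.
  by have [-> _] := rotf p; rewrite /=; ring.
have rot2 p : f2 (th p) = sin a * f1 p + cos a * f2 p.
  by have [_ ->] := rotf p; rewrite /=; ring.
have L2lin (x y : R) : (fun p => x * f1 p + y * f2 p) \in Lfun mu 2%:E.
  apply/Lfun2P; split; first by apply: measurable_funD; exact: measurable_funM.
  have mxf : measurable_fun setT (fun p => x * f1 p) by exact: measurable_funM.
  apply: (le_lt_trans (sqint_le_lin _ _ mxf mf2)).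
  have y2 : (0 <= (2 * y ^+ 2)%R%:E)%E by rewrite lee_fin mulr_ge0// sqr_ge0.
  rewrite lte_add_pinfty ?lte_mul_pinfty//.
  have m0 : measurable_fun setT (fun _ : E => 0 : R) by exact: measurable_cst.
  have -> : sqint mu (fun p => x * f1 p) = sqint mu (fun p => 0 + x * f1 p).
    by congr (sqint mu _); apply/funext => p; rewrite add0r.
  apply: (le_lt_trans (sqint_le_lin _ _ m0 mf1)).
  have x2 : (0 <= (2 * x ^+ 2)%R%:E)%E by rewrite lee_fin mulr_ge0// sqr_ge0.
  rewrite lte_add_pinfty ?lte_mul_pinfty//.
  rewrite /sqint (eq_integral (cst 0%E)) ?integral0 ?ltry// => p _.
  by rewrite expr0n.
have Lth1 : f1 \o th \in Lfun mu 2%:E.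
  by rewrite (_ : f1 \o th = fun p => cos a * f1 p + - sin a * f2 p)//; exact/funext.
have Lth2 : f2 \o th \in Lfun mu 2%:E.
  by rewrite (_ : f2 \o th = fun p => sin a * f1 p + cos a * f2 p)//; exact/funext.
pose g n := truncated_pair (phi n) f1 f2.
pose h n := truncated_pair (phi n) (f1 \o th) (f2 \o th).
have mg n : measurable_fun setT (g n) by exact: measurable_truncated_pair L1 L2.
have mh n : measurable_fun setT (h n) by exact: measurable_truncated_pair Lth1 Lth2.
have fg n : finite_set (range (g n)) by exact: finite_range_truncated_pair.
have fh n : finite_set (range (h n)) by exact: finite_range_truncated_pair.
have goo n (v : R * R) : v != 0%R -> (mu (g n @^-1` [set v]) < +oo)%E.
  exact: (truncated_pair_fiber_lty (mphi n) (phile n) L1 L2).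
have hoo n (v : R * R) : v != 0%R -> (mu (h n @^-1` [set v]) < +oo)%E.
  exact: (truncated_pair_fiber_lty (mphi n) (phile n) Lth1 Lth2).
have [tg1 tg2] : (forall n, tame P N mu (fun p => (g n p).1)) /\
                 (forall n, tame P N mu (fun p => (g n p).2)).
  by split => n; have [] := finite_range_tame prmN (mg n) (fg n) (goo n)
    (sqint_truncation_lty (mphi n) (phile n) L1)
    (sqint_truncation_lty (mphi n) (phile n) L2).
have [th1 th2] : (forall n, tame P N mu (fun p => (h n p).1)) /\
                 (forall n, tame P N mu (fun p => (h n p).2)).
  by split => n; have [] := finite_range_tame prmN (mh n) (fh n) (hoo n)
    (sqint_truncation_lty (mphi n) (phile n) Lth1)
    (sqint_truncation_lty (mphi n) (phile n) Lth2).
have cg1 := truncation_sqint_cvg0 mphi phile phicvg L1.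
have cg2 := truncation_sqint_cvg0 mphi phile phicvg L2.
have ch1 : sqint mu (fun p => (h n p).1 - (cos a * f1 p + - sin a * f2 p))
    @[n --> \oo] --> 0%E.
  apply: eq_sqint_cvg (truncation_sqint_cvg0 mphi phile phicvg Lth1) => n p.
  by rewrite -rot1.
have ch2 : sqint mu (fun p => (h n p).2 - (sin a * f1 p + cos a * f2 p))
    @[n --> \oo] --> 0%E.
  apply: eq_sqint_cvg (truncation_sqint_cvg0 mphi phile phicvg Lth2) => n p.
  by rewrite -rot2.
pose X n w := (compensated N mu (fun p => (g n p).1) w,
               compensated N mu (fun p => (g n p).2) w).
pose Y n w := (compensated N mu (fun p => (h n p).1) w,
               compensated N mu (fun p => (h n p).2) w).
have mcomp (k : E -> R * R) : measurable_fun setT k -> measurable_fun setT (fun w =>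
    (compensated N mu (fun p => (k p).1) w, compensated N mu (fun p => (k p).2) w)).
  by move=> mk; apply: measurable_fun_pair; apply: (measurable_compensated prmN);
    exact: measurableT_comp.
have XY n B : measurable B -> P (X n @^-1` B) = P (Y n @^-1` B).
  move=> mB.
  pose c : R * R := (\int[mu]_p (g n p).1, \int[mu]_p (g n p).2).
  pose B' := [set z : R * R | B (z - c)].
  have mB' : measurable B'.
    rewrite -[X in measurable X]setTI.
    have : measurable_fun setT (fun z : R * R => z - c).
      by apply: measurable_fun_pair; apply: measurable_funB.
    exact.
  have c1 : \int[mu]_p (h n p).1 = c.1.
    exact: (Rintegral_preserved (pr := fst) (or_introl erefl) (mg n) (fg n) (goo n)).
  have c2 : \int[mu]_p (h n p).2 = c.2.
    exact: (Rintegral_preserved (pr := snd) (or_intror erefl) (mg n) (fg n) (goo n)).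
  have := integral_pair_law prmN (mg n) (fg n) (goo n) mth muth mB'.
  rewrite (_ : integral_pair N (g n) @^-1` B' = X n @^-1` B)//.
  rewrite (_ : integral_pair N (g n \o th) @^-1` B' = Y n @^-1` B)//.
  by apply/seteqP; split => w; rewrite /B'/Y/compensated/= c1 c2.
symmetry; apply: (limit_law_eq (X := X) (Y := Y)
  (I := fun w => (I1 w, I2 w)) (J := fun w => rot a (I1 w, I2 w))) => //.
- by move=> n; exact: mcomp.
- by move=> n; exact: mcomp.
- exact: measurable_fun_pair.
- by apply: (measurableT_comp (measurable_rot a)); exact: measurable_fun_pair.
- exact: (compensated_cvg cI1 tg1 cg1).
- exact: (compensated_cvg cI2 tg2 cg2).
- have := compensated_cvg_lin prmN cI1 cI2 tg1 tg2 th1 cg1 cg2 ch1.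
  by apply: eq_sqint_cvg => n w /=; ring.
- have := compensated_cvg_lin prmN cI1 cI2 tg1 tg2 th2 cg1 cg2 ch2.
  by apply: eq_sqint_cvg => n w /=; ring.
Qed.

End rotation_of_compensated_integrals.

(** * Paths without jumps *)

Section paths_without_jumps.
Context (R : realType).

(** Every point is a limit from the right of rational ones. *)
Lemma cadlag_rat_zero (z : R -> R * R) (t : R) : cadlag z ->
  (forall q : rat, (0 : R) < ratr q -> ratr q < t -> z (ratr q) = 0) ->
  forall s, 0 < s < t -> z s = 0.
Proof.
move=> [zr _] zq s /andP[s0 st].
have zs := zr s (ltW s0).
have coord (pr : R * R -> R) : pr 0 = 0 -> {for z s, continuous pr} -> pr (z s) = 0.
  move=> pr0 cpr.
  have /cvgrPdist_lt H : pr (z u) @[u --> s^'+] --> pr (z s).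
    exact: (cvg_comp _ _ zs cpr).
  apply/eqP; rewrite -normr_eq0 eq_le normr_ge0 andbT.
  apply/ler_addgt0Pr => e e0; rewrite add0r.
  have [r /= r0 Hr] : \forall u \near s^'+, `|pr (z s) - pr (z u)| < e by exact: H.
  have /rat_in_itvoo[q] : s < Num.min t (s + r) by rewrite lt_min st ltrDl.
  rewrite in_itv/= lt_min => /and3P[sq qt qr].
  have := Hr (ratr q); rewrite zq//; last exact: lt_trans sq.
  rewrite pr0 subr0 => K; apply/ltW/K => //=.
  by rewrite distrC gtr0_norm ?subr_gt0// ltrBlDl.
rewrite (surjective_pairing (z s)); congr pair.
  by apply: (coord fst) => //; exact: cvg_fst.
by apply: (coord snd) => //; exact: cvg_snd.
Qed.

Lemma jump_zero (z : R -> R * R) (t s : R) :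
  (forall u, 0 < u < t -> z u = 0) -> 0 < s < t -> jump z s = 0.
Proof.
move=> z0 st; rewrite /jump z0//.
have near0 : \forall u \near s^'-, z u = 0.
  have s0 : 0 < s by case/andP: st.
  near=> u; apply: z0; apply/andP; split.
    by near: u; exact: nbhs_left_gt.
  apply: (@lt_trans _ _ s); last by case/andP: st.
  by near: u; exact: nbhs_left_lt.
have lim0 (pr : R * R -> R) : pr 0 = 0 -> lim (pr (z u) @[u --> s^'-]) = 0.
  move=> pr0; apply: cvg_lim => //; rewrite -[X in _ --> X]pr0.
  apply: cvg_near_cst; near=> u; congr pr; near: u; exact: near0.
rewrite /left_limit (lim0 fst)// (lim0 snd)//.
by rewrite -[X in _ - X]/(0 : R * R) subrr.
Unshelve. all: by end_near. Qed.

Lemma jump_count_zero (z : R -> R * R) (t : R) :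
  (forall u, 0 < u < t -> z u = 0) ->
  jump_count z (`]0, t[%classic `*` setT) = 0%E.
Proof.
move=> z0; rewrite /jump_count (_ : [set s | _] = set0).
  by rewrite /counting asboolT// fset_set0.
apply/seteqP; split => // s [s0 js [/= +  _]]; rewrite in_itv/= => st.
by apply: js; exact: jump_zero z0 st.
Qed.

End paths_without_jumps.

(** * The intensity of an isotropic Levy measure *)

Section rotated_intensity.
Context (R : realType).

Definition rot_mark (a : R) (p : R * (R * R)) : R * (R * R) := (p.1, rot a p.2).

Lemma measurable_rot_mark a : measurable_fun setT (rot_mark a).
Proof.
apply: measurable_fun_pair => //.
exact: (measurableT_comp (measurable_rot a) measurable_snd).
Qed.

Lemma time_intensity_rot_mark (sigma : {measure set (R * R) -> \bar R}) (a : R) B :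
  rotation_invariant sigma -> measurable B ->
  time_intensity sigma (rot_mark a @^-1` B) = time_intensity sigma B.
Proof.
move=> rs mB; rewrite /time_intensity /mrestr.
set D := (_ `*` _).
have mD : measurable D by exact: measurable_nonneg_times.
have mBD : measurable (B `&` D) by exact: measurableI.
have -> : rot_mark a @^-1` B `&` D = rot_mark a @^-1` (B `&` D).
  by apply/seteqP; split => -[u z] /= [].
have mphi : measurable_fun setT (fun z => lebesgue_measure (ysection (B `&` D) z)).
  exact: measurable_fun_ysection.
rewrite /product_measure2.
transitivity (\int[pushforward sigma (rot a)]_z
  lebesgue_measure (ysection (B `&` D) z))%E.
  by rewrite (ge0_integral_pushforward (measurable_rot a)).
by apply: eq_measure_integral => [|mr A mA _]; [exact: measurable_rot|exact: rs].
Qed.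

Lemma time_intensity_strip (nu : {measure set R -> \bar R}) (t : R) : 0 < t ->
  nu `]0, +oo[%classic = +oo%E ->
  time_intensity (polar_measure nu) (`]0, t[%classic `*` setT) = +oo%E.
Proof.
move=> t0 nuoo; rewrite /time_intensity /mrestr -setXI setTI.
have -> : `]0, t[%classic `&` `[0, +oo[%classic = `]0, t[%classic :> set R.
  by apply/seteqP; split => x /=; rewrite !in_itv/=; lra.
rewrite product_measure2E//= lebesgue_measure_itv/= lte_fin t0 oppr0 adde0.
have -> : polar_measure nu setT = +oo%E.
  rewrite /polar_measure /pushforward preimage_setT -setXTT product_measure1E//.
  rewrite [X in (_ * X)%E](@probability_setT _ _ _ (@uniform_angle R)) mule1.
  apply/eqP; rewrite -leye_eq -nuoo; apply: le_measure; rewrite ?inE//.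
by rewrite gt0_muley.
Qed.

End rotated_intensity.

(** * Isotropic Levy processes *)

Lemma joint_law_product (R : realType) d (T : measurableType d) (P : probability T R)
    (X Y : T -> R * R) (m1 m2 : probability (R * R)%type R) :
  measurable_fun setT X -> measurable_fun setT Y ->
  (forall A B, measurable A -> measurable B ->
     P (X @^-1` A `&` Y @^-1` B) = (m1 A * m2 B)%E) ->
  forall E, measurable E -> P [set w | E (X w, Y w)] = (m1 \x m2)%E E.
Proof.
move=> mX mY H E mE.
have mXY : measurable_fun setT (fun w => (X w, Y w)) by exact: measurable_fun_pair.
pose M' : {measure set ((R * R) * (R * R)) -> \bar R} :=
  pushforward P (fun w => (X w, Y w)).
symmetry; apply: (product_measure_unique (m' := M' mXY)) => //; exact: H.
Qed.

(** A name for the product, on which its sigma-finiteness can be declared. *)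
Definition lebesgue_plane (R : realType) :
    set (measurableTypeR R * measurableTypeR R) -> \bar R :=
  (@lebesgue_measure R \x @lebesgue_measure R)%E.

HB.instance Definition _ (R : realType) := Measure.on (@lebesgue_plane R).

Lemma lebesgue_plane_sigma_finite (R : realType) :
  sigma_finite setT (@lebesgue_plane R).
Proof.
pose I n : set R := `[- n%:R, n%:R]%classic.
exists (fun n => I n `*` I n).
  apply/seteqP; split => // -[x y] _.
  exists (Num.truncn (Num.max `|x| `|y|)).+1 => //.
  have := truncnS_gt (Num.max `|x| `|y|); rewrite gt_max => /andP[/ltW xn /ltW yn].
  by split; rewrite /I/= in_itv/= -ler_norml.
move=> n; have mI : measurable (I n : set (measurableTypeR R)) by exact: measurable_itv.
split; first exact: measurableX.
rewrite [X in (X < _)%E]product_measure1E//.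
have In : (lebesgue_measure (I n) < +oo)%E.
  by rewrite /I lebesgue_measure_itv/=; case: ifPn; rewrite ?ltry.
by rewrite lte_mul_pinfty// ge0_fin_numE.
Qed.

HB.instance Definition _ (R : realType) := Measure_isSigmaFinite.Build _ _ _
  (@lebesgue_plane R) (@lebesgue_plane_sigma_finite R).

Lemma dominated_density (R : realType) d (T : measurableType d) (P : probability T R)
    (X : T -> R * R) : measurable_fun setT X ->
  (forall A : set (R * R), measurable A ->
    (@lebesgue_measure R \x @lebesgue_measure R)%E A = 0%E -> P (X @^-1` A) = 0%E) ->
  has_density P X.
Proof.
move=> mX dom; have mX' : measurable_fun setT
  (X : T -> (measurableTypeR R * measurableTypeR R)%type) by exact: mX.
have [m mE] := law_exists P mX'.
have mdom : m `<< @lebesgue_plane R.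
  by apply/null_content_dominatesP => A mA A0; rewrite [LHS](mE _ mA); exact: dom.
have [f [f0 ffin fint fE]] := radon_nikodym_sigma_finite mdom.
exists (fine \o f); split.
- apply: measurableT_comp; first exact: fine_measurable.
  exact: (measurable_int _ fint).
- by move=> z; rewrite fine_ge0.
- move=> A mA; rewrite -(mE _ mA) [LHS](fE _ mA).
  by apply: eq_integral => z _; rewrite /= fineK.
Qed.

Section isotropic_levy_process.
Context (R : realType) d (T : measurableType d) (P : probability T R).
Variables (Z : R -> T -> R * R) (N : T -> {measure set (R * (R * R)) -> \bar R})
  (nu : {measure set R -> \bar R}).
Let sigma : {measure set (R * R) -> \bar R} := polar_measure nu.
Hypotheses (levyZ : levy_process P Z) (jumpsN : jump_measure_of P Z N)
  (prmN : poisson_random_measure P N (time_intensity sigma))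
  (centered : centered_without_gaussian_part P Z N (time_intensity sigma))
  (nuoo : nu `]0, +oo[%classic = +oo%E).

Lemma levy_law_rotation_invariant t a A : 0 <= t -> measurable A ->
  P [set w | A (rot a (Z t w))] = P (Z t @^-1` A).
Proof.
move=> t0 mA; have [c1 c2] := centered t0.
have rs : rotation_invariant sigma by exact: polar_measure_rotation_invariant.
rewrite (_ : Z t @^-1` A = [set w | A ((Z t w).1, (Z t w).2)]); last first.
  by apply/seteqP; split => w /=; rewrite -surjective_pairing.
apply: (compensated_pair_rotation prmN (measurable_rot_mark a)
  (fun B mB => time_intensity_rot_mark a rs mB) c1 c2 _ mA) => p.
by rewrite /rot/rot_mark/=; congr pair; ring.
Qed.

Lemma levy_law t : 0 <= t -> exists m : probability (R * R)%type R,
  rotation_invariant m /\ forall A, measurable A -> m A = P (Z t @^-1` A).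
Proof.
move=> t0; have [m mE] := law_exists P (levy_measurable levyZ t0).
exists m; split => // a A mA.
rewrite [LHS](mE _ (measurable_preimage_rot a mA)) [RHS](mE _ mA).
exact: levy_law_rotation_invariant.
Qed.

(** The first increment starts from Z 0, which vanishes almost surely. *)
Lemma levy_increment_law s t (m1 m2 : probability (R * R)%type R) :
  0 <= s -> s <= t ->
  (forall A, measurable A -> m1 A = P (Z s @^-1` A)) ->
  (forall A, measurable A -> m2 A = P (Z (t - s) @^-1` A)) ->
  forall E, measurable E -> P [set w | E (Z s w, Z t w - Z s w)] = (m1 \x m2)%E E.
Proof.
move=> s0 st m1E m2E.
have t0 : 0 <= t by exact: le_trans st.
have mZ u : 0 <= u -> measurable_fun setT (Z u) by exact: (levy_measurable levyZ).
have mB u v : 0 <= u -> 0 <= v -> measurable_fun setT (fun w => Z u w - Z v w).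
  by move=> u0 v0; apply: measurable_fun_pair; apply: measurable_funB;
    apply: measurableT_comp => //; exact: mZ.
apply: (joint_law_product (mZ s s0) (mB t s t0 s0)) => A B mA mB'.
(* Increments over [0, s] and [s, t]. *)
pose tt (k : nat) := if k is 0%N then 0 else if k is 1%N then s else t.
have ttmono : {homo tt : i j / (i <= j)%N >-> i <= j}.
  by move=> [|[|i]] [|[|j]].
have := levy_independent_increments levyZ (n := 2) (t := tt) (lexx 0) ttmono.
pose BB (i : 'I_2) := if val i is 0%N then A else B.
move=> /(_ BB); rewrite big_ord_recl big_ord_recl big_ord0 mule1 /=.
have mBB i : measurable (BB i) by rewrite /BB; case: (val i).
move=> /(_ mBB) H.
have pre u v C : 0 <= u -> 0 <= v -> measurable C ->
    measurable ((fun w => Z u w - Z v w) @^-1` C).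
  by move=> u0 v0 mC; rewrite -[X in measurable X]setTI; exact: mB.
have preZ u C : 0 <= u -> measurable C -> measurable (Z u @^-1` C).
  by move=> u0 mC; rewrite -[X in measurable X]setTI; exact: mZ.
have Z0 : {ae P, forall w, (Z s w - Z 0 w) = Z s w}.
  by apply: ae_imply (levy_start levyZ) => w ->; rewrite subr0.
transitivity (P ((fun w => Z s w - Z 0 w) @^-1` A `&`
                 (fun w => Z t w - Z s w) @^-1` B)).
  apply: ae_eq_measure.
  - by apply: measurableI; [exact: preZ|exact: pre].
  - by apply: measurableI; exact: pre.
  - by apply: ae_imply Z0 => w; rewrite /setI/preimage/= => ->.
transitivity (P ((fun w => (Z s w - Z 0 w)%R) @^-1` A) *
              P ((fun w => (Z t w - Z s w)%R) @^-1` B))%E.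
  rewrite -[RHS]H; congr (P _); apply/seteqP; split => w /=.
    move=> [hA hB] i _; case: i => [[|[|//]]] /= i2; [exact: hA|exact: hB].
  move=> h; split; first exact: (h (Ordinal (isT : (0 < 2)%N)) I).
  exact: (h (Ordinal (isT : (1 < 2)%N)) I).
congr (_ * _)%E.
- rewrite [RHS]m1E//; apply: ae_eq_measure; [exact: pre|exact: preZ|].
  by apply: ae_imply Z0 => w; rewrite /preimage/= => ->.
- rewrite [RHS]m2E// -(levy_stationary_increments levyZ s0 (_ : 0 <= t - s))//.
    by rewrite subrKC.
  by rewrite subr_ge0.
Qed.

(** Z t is the sum of the independent isotropic vectors Z s and Z t - Z s, which
    cancel only if both vanish. *)
Lemma levy_no_return s t : 0 <= s -> s <= t ->
  {ae P, forall w, Z t w = 0 -> Z s w = 0}.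
Proof.
move=> s0 st; have ts0 : 0 <= t - s by rewrite subr_ge0.
have [m1 [_ m1E]] := levy_law s0; have [m2 [r2 m2E]] := levy_law ts0.
have mE : measurable [set p : (R * R) * (R * R) | p.1 + p.2 = 0 /\ p.1 != 0].
  have m0 : measurable [set p : (R * R) * (R * R) | p.1 + p.2 = 0].
    have := measurable_fun_add2 (R := R).
    by move=> /(_ measurableT _ (measurable_set1_pair 0)); rewrite setTI.
  have mn : measurable [set p : (R * R) * (R * R) | p.1 != 0].
    rewrite (_ : [set p | _] = ~` (fst @^-1` [set 0])).
      apply: measurableC; rewrite -[X in measurable X]setTI.
      by apply: measurable_fst => //; exact: measurable_set1_pair.
    by apply/seteqP; split => p /=; [move/eqP|move/eqP].
  exact: measurableI.
have := levy_increment_law s0 st m1E m2E mE.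
rewrite opposite_pair_null// => P0.
exists [set w | (Z s w + (Z t w - Z s w) = 0) /\ Z s w != 0]; split => //.
- have t0 : 0 <= t by exact: le_trans st.
  have mp : measurable_fun setT (fun w => (Z s w, Z t w - Z s w)).
    have mZ u : 0 <= u -> measurable_fun setT (Z u) by exact: (levy_measurable levyZ).
    apply: measurable_fun_pair; first exact: mZ.
    by apply: measurable_fun_pair; apply: measurable_funB;
      apply: measurableT_comp => //; exact: mZ.
  by have := mp measurableT _ mE; rewrite setTI.
- move=> w /= /not_implyP[Zt Zs]; rewrite addrC subrK; split => //.
  exact/eqP.
Qed.

(** On the event Z t = 0 the path vanishes at all rational times before t, hence
    on all of ]0, t[ by right continuity, and has no jump there; but the number of
    jumps before t is Poisson with infinite mean, hence almost surely infinite. *)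
Lemma levy_no_atom t : 0 < t -> P (Z t @^-1` [set 0]) = 0%E.
Proof.
move=> t0.
have mZt : measurable (Z t @^-1` [set 0]).
  rewrite -[X in measurable X]setTI; apply: (levy_measurable levyZ (ltW t0)) => //.
  exact: measurable_set1_pair.
have mS : measurable (`]0, t[%classic `*` setT : set (R * (R * R))).
  exact: measurableX.
have Noo : {ae P, forall w, N w (`]0, t[%classic `*` setT) = +oo%E}.
  have := prm_poisson prmN mS.
  rewrite [X in poisson_distributed _ _ X](time_intensity_strip t0 nuoo) => P1.
  exists (~` [set w | N w (`]0, t[%classic `*` setT) = +oo%E]); split => //.
    apply: measurableC; rewrite -[X in measurable X]setTI.
    exact: (prm_measurable prmN mS measurableT (emeasurable_set1 +oo%E)).
  rewrite probability_setC; first by rewrite [X in (_ - X)%E]P1 subee.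
  rewrite -[X in measurable X]setTI.
  exact: (prm_measurable prmN mS measurableT (emeasurable_set1 +oo%E)).
have Zq : {ae P, forall w, forall q : rat, (0 : R) < ratr q -> ratr q < t ->
    Z t w = 0 -> Z (ratr q) w = 0}.
  have : {ae P, forall w, forall n, forall q : rat, unpickle n = Some q ->
      (0 : R) < ratr q -> ratr q < t -> Z t w = 0 -> Z (ratr q) w = 0}.
    apply: ae_foralln => n.
    case: (@unpickle rat n) => [q|]; last by apply: aeW.
    have [q0|q0] := ltP (0 : R) (ratr q); last first.
      by apply: aeW => w q' [<-]; rewrite ltNge q0.
    have [qt|qt] := ltP (ratr q) t; last first.
      by apply: aeW => w q' [<-] _; rewrite ltNge qt.
    by apply: ae_imply (levy_no_return (ltW q0) (ltW qt)) => w h q' [<-].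
  by apply: ae_imply => w h q; apply: (h (pickle q)); rewrite pickleK.
apply/(negligibleP P mZt).
have : {ae P, forall w, Z t w <> 0}.
  have NJ := ae_imply2 (fun w h1 h2 => conj h1 h2) Noo jumpsN.
  have ZC := ae_imply2 (fun w h1 h2 => conj h1 h2) Zq (levy_cadlag levyZ).
  apply: (ae_imply2 _ NJ ZC) => w [Nw Jw] [qw cw] Zt0.
  have zero := cadlag_rat_zero cw (fun q q0 qt => qw q q0 qt Zt0).
  by have := Jw _ mS; rewrite Nw jump_count_zero.
by apply: negligibleS => w /= ->.
Qed.

End isotropic_levy_process.

Theorem mainTheorem2 (R : realType) (d : measure_display)
    (T : measurableType d) (P : probability T R)
    (Z : R -> T -> R * R)
    (N : T -> {measure set (R * (R * R)) -> \bar R})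
    (nu : {measure set R -> \bar R}) :
  let sigma : {measure set (R * R) -> \bar R} := polar_measure nu in
  levy_process P Z ->
  nu `]-oo, 0]%classic = 0%E ->
  jump_measure_of P Z N ->
  poisson_random_measure P N (time_intensity sigma) ->
  centered_without_gaussian_part P Z N (time_intensity sigma) ->
  (\int[sigma]_z (z.1 ^+ 2 + z.2 ^+ 2)%:E < +oo)%E ->
  nu `]0, +oo[%classic = +oo%E ->
  forall t : R, 0 < t -> has_density P (Z t).
Proof.
move=> sigma levyZ _ jumpsN prmN centered _ nuoo t t0.
(* Z t is the sum of Z (t / 2) and of an independent copy of it. *)
have s0 : 0 < t / 2 by rewrite divr_gt0.
have st : t / 2 <= t by lra.
have [m [rm mE]] := levy_law levyZ prmN centered (ltW s0).
have [mt [rmt mtE]] := levy_law levyZ prmN centered (ltW t0).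
have m2E A : measurable A -> m A = P (Z (t - t / 2) @^-1` A).
  by move=> mA; rewrite (_ : t - t / 2 = t / 2) ?mE//; lra.
have m0 : m [set 0] = 0%E.
  rewrite [LHS]mE; first exact: (levy_no_atom levyZ jumpsN prmN centered nuoo s0).
  exact: measurable_set1_pair.
apply: dominated_density; first exact: levy_measurable levyZ _ (ltW t0).
move=> A mA A0; rewrite -(mtE _ mA).
apply: (sum_dominated rm m0 m0 rmt _ mA A0) => B mB.
rewrite -(levy_increment_law levyZ (ltW s0) st mE m2E (E := [set p | B (p.1 + p.2)])).
  rewrite [LHS]mtE//; congr (P _).
  by apply/seteqP; split => w /=; rewrite addrC subrK.
have := measurable_fun_add2 (R := R).
by move=> /(_ measurableT _ mB); rewrite setTI.
Qed.
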